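(* Let $(M,g)$ be a semi-Riemannian manifold of dimension $n\ge3$ satisfying $P\cdot P=L\,Q(g,P)$ for some $L\in C^\infty(M)$. Then: (i) $P\cdot R=L\,Q(g,R)$ if and only if $R\cdot(\wedge_S)=L\,Q(g,\wedge_S)+\frac{1}{n-1}Q(S,\wedge_S)$. (ii) $R\cdot P=L\,Q(g,P)$ if and only if $Q(S,P)=0$. (iii) $R\cdot R=L\,Q(g,R)$ if and only if $Q(S,P)=0$. (iv) $n(n-1)\,R\cdot S=(n^2L-nL+\kappa)\,Q(g,S)$. (v) $(n-1)E=\kappa S-S^2$. (vi) $n^2S^2-2n\kappa S+\kappa^2g=0$ and $\kappa^{(2)}=\frac{\kappa^2}{n}$. Moreover, if $M$ is a Riemannian manifold, then it is an Einstein manifold. (vii) $L\,n^2(nS-\kappa g)=0$. Moreover, if $L$ is nowhere zero, then $M$ is an Einstein manifold.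
   Context: $(M,g)$ is a connected smooth semi-Riemannian manifold of dimension $n\ge 3$; $R$ is the $(0,4)$ Riemann curvature tensor, with the sign convention that the Ricci tensor $S(X_2,X_3)$ is the $g$-trace of $R(X_1,X_2,X_3,X_4)$ over $X_1,X_4$; $\kappa$ is the scalar curvature; $\mathcal S$ is the Ricci operator, $g(\mathcal SX,Y)=S(X,Y)$, $S^2(X,Y)=g(\mathcal S^2X,Y)$, $\kappa^{(2)}=\mathrm{trace}(\mathcal S^2)$. $E(X,Y)$ is the $(0,2)$-tensor obtained by contracting $R(X_1,X,Y,\mathcal SX_2)$ over $X_1,X_2$. Einstein means $S=\frac{\kappa}{n}g$. Projective curvature tensor: $P(X_1,X_2,X_3,X_4)=R(X_1,X_2,X_3,X_4)-\frac{1}{n-1}\left[S(X_2,X_3)g(X_1,X_4)-S(X_1,X_3)g(X_2,X_4)\right]$. For a $(0,4)$-tensor $D$, let $\mathcal D$ be the $(1,3)$-tensor with $g(\mathcal D(X,Y)X_1,X_2)=D(X,Y,X_1,X_2)$. For a $(0,k)$-tensor $H$, $(D\cdot H)(X_1,\dots,X_k,X,Y)=-\sum_{i=1}^kH(X_1,\dots,\mathcal D(X,Y)X_i,\dots,X_k)$. For a symmetric $(0,2)$-tensor $A$, $(X\wedge_AY)Z=A(Y,Z)X-A(X,Z)Y$ and $Q(A,H)(X_1,\dots,X_k,X,Y)=-\sum_{i=1}^k H(X_1,\dots,(X\wedge_AY)X_i,\dots,X_k)$. $\wedge_S$ denotes the $(0,4)$-tensor $\wedge_S(X_1,X_2,X_3,X_4)=S(X_2,X_3)g(X_1,X_4)-S(X_1,X_3)g(X_2,X_4)$.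 *)

(* Defs.v *)
From HB Require Import structures.
From mathcomp Require Import all_boot all_order all_algebra.
From mathcomp Require Import all_classical all_reals all_analysis.

Set Implicit Arguments.
Unset Strict Implicit.
Unset Printing Implicit Defensive.
Import Order.TTheory GRing.Theory Num.Theory.
Import numFieldNormedType.Exports.
Local Open Scope classical_set_scope.
Local Open Scope ring_scope.

Definition evec (R : realType) (n : nat) (a : 'I_n) : 'rV[R]_n := delta_mx 0 a.

Definition pderiv (R : realType) (n : nat) (a : 'I_n) (f : 'rV[R]_n -> R)
  (x : 'rV[R]_n) : R := 'D_(evec R a) f x.

(* Meant for open U: all partial derivatives of order <= k exist and are
   continuous on U. *)
Fixpoint Ck_on (R : realType) (n k : nat) (U : set 'rV[R]_n)
    (f : 'rV[R]_n -> R) {struct k} : Prop :=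
  (forall x, U x -> {for x, continuous f}) /\
  (if k is k'.+1 then
     forall a : 'I_n,
       (forall x, U x -> derivable f x (evec R a)) /\ Ck_on k' U (pderiv a f)
   else True).

Definition smooth_on (R : realType) (n : nat) (U : set 'rV[R]_n)
  (f : 'rV[R]_n -> R) : Prop := forall k, Ck_on k U f.

(* [coord c] is a homeomorphism from the open set [dom c] onto an open subset
   of R^n, with inverse [point c]; both maps are total functions, with
   irrelevant values outside of these sets. *)
Record smoothManifold (R : realType) (n : nat) := SmoothManifold {
  carrier :> topologicalType;
  chart : Type;
  dom : chart -> set carrier;
  coord : chart -> carrier -> 'rV[R]_n;
  point : chart -> 'rV[R]_n -> carrier;
  manifold_hausdorff : hausdorff_space carrier;
  manifold_second_countable : @second_countable carrier;
  dom_open : forall c, open (dom c);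
  dom_cover : forall p, exists c, dom c p;
  coord_open : forall c, open (coord c @` dom c);
  coordK : forall c p, dom c p -> point c (coord c p) = p;
  coord_continuous : forall c p, dom c p -> {for p, continuous (coord c)};
  point_continuous : forall c x, (coord c @` dom c) x ->
    {for x, continuous (point c)};
  transition_smooth : forall c d (b : 'I_n),
    smooth_on (coord c @` (dom c `&` dom d))
      (fun x => coord d (point c x) 0 b)
}.

Definition smooth_fun (R : realType) (n : nat) (M : smoothManifold R n)
  (f : M -> R) : Prop :=
  forall c : chart M, smooth_on (coord c @` dom c) (fun x => f (point c x)).

(* [gram c x] is the Gram matrix, at the point of coordinates x, of the metric
   in the coordinate frame of the chart c.  Row vectors are the components of
   tangent vectors; a change of chart multiplies them on the right by
   the Jacobian matrix of the transition map. *)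
Record semiRiemannianMetric (R : realType) (n : nat) (M : smoothManifold R n) :=
  SemiRiemannianMetric {
  gram : chart M -> 'rV[R]_n -> 'M[R]_n;
  gram_smooth : forall c (a b : 'I_n),
    smooth_on (coord c @` dom c) (fun x => gram c x a b);
  gram_sym : forall c x, (coord c @` dom c) x -> (gram c x)^T = gram c x;
  gram_nondegenerate : forall c x, (coord c @` dom c) x ->
    gram c x \in unitmx;
  gram_transition : forall c d x, (coord c @` (dom c `&` dom d)) x ->
    let F := fun y => coord d (point c y) in
    gram c x = jacobian F x *m gram d (F x) *m (jacobian F x)^T
}.

(* The Christoffel symbol Gamma^e_(a b) of the metric G. *)
Definition christoffel (R : realType) (n : nat) (G : 'rV[R]_n -> 'M[R]_n)
  (e a b : 'I_n) (x : 'rV[R]_n) : R :=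
  2^-1 * \sum_(f < n) invmx (G x) e f *
    (pderiv a (fun y => G y b f) x + pderiv b (fun y => G y a f) x
     - pderiv f (fun y => G y a b) x).

(* The component along the e-th coordinate field of
   (nabla_a nabla_b - nabla_b nabla_a) applied to the d-th coordinate field. *)
Definition curvature_comp (R : realType) (n : nat) (G : 'rV[R]_n -> 'M[R]_n)
  (e a b d : 'I_n) (x : 'rV[R]_n) : R :=
  pderiv a (christoffel G e b d) x - pderiv b (christoffel G e a d) x
  + \sum_(f < n) (christoffel G e a f x * christoffel G f b d x
                  - christoffel G e b f x * christoffel G f a d x).

Definition curvature_op (R : realType) (n : nat) (G : 'rV[R]_n -> 'M[R]_n)
  (x X Y Z : 'rV[R]_n) : 'rV[R]_n :=
  \row_(e < n) \sum_(a < n) \sum_(b < n) \sum_(d < n)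
    curvature_comp G e a b d x * X 0 a * Y 0 b * Z 0 d.

(* A (0,k)-tensor on R^n; the arguments X_1, ..., X_k are x`_0, ..., x`_k.-1. *)
Definition tensor (R : realType) (n k : nat) := k.-tuple 'rV[R]_n -> R.

(* A tensor field, given for each chart c and each point p of [dom c] by its
   expression in the coordinate frame of c at p.  Identities between tensor
   fields are required in every chart of the atlas, see [everywhere]. *)
Definition tfield (R : realType) (n : nat) (M : smoothManifold R n) (k : nat) :=
  chart M -> M -> tensor R n k.

Definition sfield (R : realType) (n : nat) (M : smoothManifold R n) :=
  chart M -> M -> R.

Definition everywhere (R : realType) (n : nat) (M : smoothManifold R n)
  (F : chart M -> M -> Prop) : Prop := forall c p, dom c p -> F c p.

Definition gram_at (R : realType) (n : nat) (M : smoothManifold R n)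
  (g : semiRiemannianMetric M) (c : chart M) (p : M) : 'M[R]_n :=
  gram g c (coord c p).

Definition metric (R : realType) (n : nat) (M : smoothManifold R n)
  (g : semiRiemannianMetric M) : tfield M 2 :=
  fun c p x => (x`_0 *m gram_at g c p *m (x`_1)^T) 0 0.

(* The g-contraction of a bilinear form B. *)
Definition contract (R : realType) (n : nat) (M : smoothManifold R n)
  (g : semiRiemannianMetric M) (c : chart M) (p : M)
  (B : 'rV[R]_n -> 'rV[R]_n -> R) : R :=
  \sum_(a < n) \sum_(b < n)
    invmx (gram_at g c p) a b * B (evec R a) (evec R b).

(* The vector v such that g(v, W) = w(W) for all W, where w is a linear form. *)
Definition sharp (R : realType) (n : nat) (M : smoothManifold R n)
  (g : semiRiemannianMetric M) (c : chart M) (p : M)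
  (w : 'rV[R]_n -> R) : 'rV[R]_n :=
  \row_(b < n) \sum_(a < n) w (evec R a) * invmx (gram_at g c p) a b.

(* The (1,3)-tensor associated to D: g(endo D(X, Y) Z, W) = D(X, Y, Z, W). *)
Definition endo (R : realType) (n : nat) (M : smoothManifold R n)
  (g : semiRiemannianMetric M) (D : tfield M 4) (c : chart M) (p : M)
  (X Y Z : 'rV[R]_n) : 'rV[R]_n :=
  sharp g c p (fun W => D c p [tuple X; Y; Z; W]).

(* - \sum_i H(X_1, ..., T X_i, ..., X_k) *)
Definition derivation (R : realType) (n k : nat) (T : 'rV[R]_n -> 'rV[R]_n)
  (H : tensor R n k) : tensor R n k :=
  fun x => - \sum_(i < k)
    H [tuple if j == i then T (tnth x j) else tnth x j | j < k].

(* [dot g D H] is D . H, and [tachibana A H] below is Q(A, H); their arguments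
   are ordered as (X_1, ..., X_k, X, Y). *)
Definition dot (R : realType) (n : nat) (M : smoothManifold R n)
  (g : semiRiemannianMetric M) (k : nat) (D : tfield M 4) (H : tfield M k) :
  tfield M k.+2 :=
  fun c p x => derivation (endo g D c p x`_k x`_k.+1) (H c p)
                 [tuple x`_i | i < k].

Definition wedge (R : realType) (n : nat) (A : tensor R n 2)
  (X Y Z : 'rV[R]_n) : 'rV[R]_n :=
  A [tuple Y; Z] *: X - A [tuple X; Z] *: Y.

Definition tachibana (R : realType) (n : nat) (M : smoothManifold R n) (k : nat)
  (A : tfield M 2) (H : tfield M k) : tfield M k.+2 :=
  fun c p x => derivation (wedge (A c p) x`_k x`_k.+1) (H c p)
                 [tuple x`_i | i < k].

Definition riemann (R : realType) (n : nat) (M : smoothManifold R n)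
  (g : semiRiemannianMetric M) : tfield M 4 :=
  fun c p x => metric g c p
    [tuple curvature_op (gram g c) (coord c p) x`_0 x`_1 x`_2; x`_3].

Definition ricci (R : realType) (n : nat) (M : smoothManifold R n)
  (g : semiRiemannianMetric M) : tfield M 2 :=
  fun c p x =>
    contract g c p (fun U W => riemann g c p [tuple U; x`_0; x`_1; W]).

Definition scalar_curvature (R : realType) (n : nat) (M : smoothManifold R n)
  (g : semiRiemannianMetric M) : sfield M :=
  fun c p => contract g c p (fun U W => ricci g c p [tuple U; W]).

Definition ricci_op (R : realType) (n : nat) (M : smoothManifold R n)
  (g : semiRiemannianMetric M) (c : chart M) (p : M) (X : 'rV[R]_n) :
  'rV[R]_n :=
  sharp g c p (fun Y => ricci g c p [tuple X; Y]).

Definition ricci2 (R : realType) (n : nat) (M : smoothManifold R n)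
  (g : semiRiemannianMetric M) : tfield M 2 :=
  fun c p x =>
    metric g c p [tuple ricci_op g c p (ricci_op g c p x`_0); x`_1].

Definition scalar_curvature2 (R : realType) (n : nat) (M : smoothManifold R n)
  (g : semiRiemannianMetric M) : sfield M :=
  fun c p => \tr (lin1_mx (ricci_op g c p \o ricci_op g c p)).

Definition tensorE (R : realType) (n : nat) (M : smoothManifold R n)
  (g : semiRiemannianMetric M) : tfield M 2 :=
  fun c p x => contract g c p
    (fun U W => riemann g c p [tuple U; x`_0; x`_1; ricci_op g c p W]).

Definition wedgeS (R : realType) (n : nat) (M : smoothManifold R n)
  (g : semiRiemannianMetric M) : tfield M 4 :=
  fun c p x =>
    ricci g c p [tuple x`_1; x`_2] * metric g c p [tuple x`_0; x`_3]
    - ricci g c p [tuple x`_0; x`_2] * metric g c p [tuple x`_1; x`_3].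

Definition projective (R : realType) (n : nat) (M : smoothManifold R n)
  (g : semiRiemannianMetric M) : tfield M 4 :=
  fun c p x => riemann g c p x - (n%:R - 1)^-1 *
    (ricci g c p [tuple x`_1; x`_2] * metric g c p [tuple x`_0; x`_3]
     - ricci g c p [tuple x`_0; x`_2] * metric g c p [tuple x`_1; x`_3]).

Definition einstein (R : realType) (n : nat) (M : smoothManifold R n)
  (g : semiRiemannianMetric M) : Prop :=
  everywhere (fun c p => forall x,
    ricci g c p x = scalar_curvature g c p / n%:R * metric g c p x).

Definition riemannian (R : realType) (n : nat) (M : smoothManifold R n)
  (g : semiRiemannianMetric M) : Prop :=
  everywhere (fun c p => forall X : 'rV[R]_n,
    X != 0 -> 0 < metric g c p [tuple X; X]).

(* Main.v *)
(* Fix a point and let k = 1/(n-1).  Since the operator of P(X,Y) is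
   R(X,Y) - k (X /\_S Y), one has P.H = R.H - k Q(S,H) for every H; this gives
   (i) and (ii) by linearity.  As R(X,Y) and X /\_g Y are skew for g, the
   derivations R. and Q(g,.) commute with contractions and kill g, so each of
   R.R = L Q(g,R) and R.P = L Q(g,P) contracts to R.S = L Q(g,S), whence (iii).
   Contracting the hypothesis over the outer arguments, where P is trace free,
   leaves
     R(X,Z,W,SY) + R(SY,Z,W,X) - R(Y,Z,W,SX) - R(SX,Z,W,Y)
     + k [S(X,W)S(Z,Y) + S^2(Y,W)g(Z,X) - S(Y,W)S(Z,X) - S^2(X,W)g(Z,Y)] = 0.
   Its contraction over X, Z is (v).  Its curvature terms are symmetric in Z, W,
   so the bracket is too; contracting once and twice the resulting quadratic
   identity for S yields (vi).  Contracting the hypothesis over the inner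
   arguments of P, whose trace is k (nS - kappa g), gives (iv), and contracting
   (iv) gives (vii).

   The algebraic symmetries of R come from the coordinate formula; the skewness
   of R in its last two arguments rests on the symmetry of second partial
   derivatives of the metric, which is proved by two mean value theorems. *)
Require Import Defs.
From HB Require Import structures.
From mathcomp Require Import all_boot all_order all_algebra.
From mathcomp Require Import all_classical all_reals all_analysis.
From mathcomp Require Import ring lra.
Set Implicit Arguments.
Unset Strict Implicit.
Unset Printing Implicit Defensive.
Import Order.TTheory GRing.Theory Num.Theory.
Import numFieldNormedType.Exports.
Local Open Scope classical_set_scope.
Local Open Scope ring_scope.

(** * Contractions with respect to a symmetric matrix *)

Section Contraction.
Variables (R : realFieldType) (n : nat) (G : 'M[R]_n).
Local Notation V := 'rV[R]_n.
Implicit Types (f : V -> R) (B : V -> V -> R) (T : V -> V) (X Y u w : V).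

(** A bare predicate, because the forms at hand are partial applications of tensors, which are plain
    functions. *)
Definition linear_form f := forall k u w, f (k *: u + w) = k * f u + f w.

Definition bilinear_form B :=
  (forall w, linear_form (B^~ w)) /\ (forall u, linear_form (B u)).

Lemma linear_formD f u w : linear_form f -> f (u + w) = f u + f w.
Proof. by move=> lf; rewrite -[u]scale1r lf scale1r mul1r. Qed.

Lemma linear_form0 f : linear_form f -> f 0 = 0.
Proof.
by move=> lf; have := lf (-1) 0 0; rewrite scaler0 addr0 mulN1r addNr.
Qed.

Lemma linear_formZ f k u : linear_form f -> f (k *: u) = k * f u.
Proof. by move=> lf; rewrite -[_ *: u]addr0 lf linear_form0// addr0. Qed.

Lemma linear_formB f u w : linear_form f -> f (u - w) = f u - f w.
Proof. by move=> lf; rewrite addrC -scaleN1r lf mulN1r addrC. Qed.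

Lemma linear_form_sum f u (I : Type) (r : seq I) (F : I -> V) :
  linear_form f -> f (\sum_(i <- r) F i) = \sum_(i <- r) f (F i).
Proof.
move=> lf; elim: r => [|i r IH]; first by rewrite !big_nil linear_form0.
by rewrite !big_cons linear_formD// IH.
Qed.

Lemma linear_formE f u :
  linear_form f -> f u = \sum_(a < n) u 0 a * f (delta_mx 0 a).
Proof.
move=> lf; rewrite {1}[u]row_sum_delta linear_form_sum//.
by apply: eq_bigr => a _; rewrite linear_formZ.
Qed.

Definition form u w : R := (u *m G *m w^T) 0 0.

(** Convertible to [contract] of the statement, as [raise] is to [sharp]; the algebraic identities
    therefore transfer by conversion. *)
Definition trace B : R :=
  \sum_(a < n) \sum_(b < n) invmx G a b * B (delta_mx 0 a) (delta_mx 0 b).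

Definition raise f : V :=
  \row_(b < n) \sum_(a < n) f (delta_mx 0 a) * invmx G a b.

Lemma form_linl w : linear_form (form^~ w).
Proof. by move=> k u v; rewrite /form !mulmxDl -!scalemxAl !mxE. Qed.

Lemma form_linr u : linear_form (form u).
Proof. by move=> k w v; rewrite /form linearP/= mulmxDr -scalemxAr !mxE. Qed.

Lemma eq_trace B1 B2 : (forall u w, B1 u w = B2 u w) -> trace B1 = trace B2.
Proof. by move=> h; do 2!apply: eq_bigr => ? _; rewrite h. Qed.

Lemma traceD B1 B2 : trace (fun u w => B1 u w + B2 u w) = trace B1 + trace B2.
Proof.
rewrite /trace -big_split; apply: eq_bigr => a _; rewrite -big_split.
by apply: eq_bigr => b _; rewrite /= mulrDr.
Qed.

Lemma traceZ k B : trace (fun u w => k * B u w) = k * trace B.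
Proof.
rewrite /trace big_distrr; apply: eq_bigr => a _; rewrite big_distrr.
by apply: eq_bigr => b _; rewrite /= mulrCA.
Qed.

Lemma traceZr k B : trace (fun u w => B u w * k) = k * trace B.
Proof. by rewrite -traceZ; apply: eq_trace => u w; rewrite mulrC. Qed.

Lemma traceN B : trace (fun u w => - B u w) = - trace B.
Proof.
by rewrite -mulN1r -traceZ; apply: eq_trace => u w; rewrite mulN1r.
Qed.

Lemma traceB B1 B2 : trace (fun u w => B1 u w - B2 u w) = trace B1 - trace B2.
Proof. by rewrite traceD traceN. Qed.

Lemma trace0 : trace (fun _ _ => 0) = 0.
Proof.
by rewrite /trace !big1// => a _; rewrite big1// => b _; rewrite mulr0.
Qed.

Lemma exchange_trace (F : V -> V -> V -> V -> R) :
  trace (fun u w => trace (fun x y => F u w x y))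
  = trace (fun x y => trace (fun u w => F u w x y)).
Proof.
rewrite /trace.
under eq_bigr => a _ do under eq_bigr => b _ do
  (rewrite mulr_sumr; under eq_bigr => c _ do rewrite mulr_sumr).
under [RHS]eq_bigr => a _ do under eq_bigr => b _ do
  (rewrite mulr_sumr; under eq_bigr => c _ do rewrite mulr_sumr).
rewrite pair_big/= [RHS]pair_big/=.
under eq_bigr => a _ do rewrite pair_big/=.
under [RHS]eq_bigr => a _ do rewrite pair_big/=.
rewrite exchange_big/=.
by do 2!apply: eq_bigr => ? _; rewrite mulrCA.
Qed.

Hypothesis Gsym : G^T = G.

Lemma form_sym u w : form u w = form w u.
Proof.
by rewrite /form -[in RHS]Gsym -[in RHS](trmxK w) -!trmx_mul mulmxA [in RHS]mxE.
Qed.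

Lemma trace_sym B : trace B = trace (fun u w => B w u).
Proof.
rewrite /trace exchange_big/=; do 2!apply: eq_bigr => ? _.
by rewrite -[in RHS]Gsym -trmx_inv mxE.
Qed.

Lemma trace_lin (B : V -> V -> V -> R) :
  (forall u w, linear_form (fun x => B x u w)) ->
  linear_form (fun x => trace (B x)).
Proof.
move=> lB k x y; rewrite -traceZ -traceD.
by apply: eq_trace => u w; rewrite lB.
Qed.

Hypothesis Gunit : G \in unitmx.

(** Contracting against g(., X) inserts X into the other slot, because the inverse Gram matrix times
    the Gram matrix is the identity. *)
Lemma trace_forml f X :
  linear_form f -> trace (fun u w => form u X * f w) = f X.
Proof.
move=> lf; rewrite /trace exchange_big/= [RHS]linear_formE//.
apply: eq_bigr => b _.
under eq_bigr => a _ do rewrite mulrA.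
rewrite -mulr_suml; congr (_ * _).
rewrite -[X in RHS](mulmxK Gunit) mxE; apply: eq_bigr => a _.
rewrite mulrC form_sym; congr (_ * _).
by rewrite /form trmx_delta -colE mxE.
Qed.

Lemma trace_formr f X :
  linear_form f -> trace (fun u w => form w X * f u) = f X.
Proof. by move=> lf; rewrite trace_sym trace_forml. Qed.

Lemma trace_form : trace form = n%:R.
Proof.
rewrite /trace.
transitivity (\tr (invmx G *m G)); last by rewrite mulVmx// mxtrace1.
rewrite /mxtrace; apply: eq_bigr => a _; rewrite mxE.
apply: eq_bigr => b _; congr (_ * _); rewrite form_sym /form.
by rewrite trmx_delta -colE mxE -rowE mxE.
Qed.

Lemma form_raise f w : linear_form f -> form (raise f) w = f w.
Proof.
move=> lf; rewrite /form.
have -> : raise f *m G = \row_a f (delta_mx 0 a).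
  have -> : raise f = (\row_a f (delta_mx 0 a)) *m invmx G.
    by apply/rowP => b; rewrite !mxE; apply: eq_bigr => a _; rewrite !mxE.
  by rewrite mulmxKV.
rewrite mxE [RHS]linear_formE//; apply: eq_bigr => a _.
by rewrite !mxE mulrC.
Qed.

Lemma form_inj u v : (forall w, form u w = form v w) -> u = v.
Proof.
move=> h; rewrite -[u](mulmxK Gunit) -[v](mulmxK Gunit); congr (_ *m _).
apply/rowP => a; have := h (delta_mx 0 a).
by rewrite /form trmx_delta -!colE !mxE.
Qed.

(* Expanding [T u] by [trace_forml] turns both sides into the double trace of
   [form x (T u) * B y w]. *)
Lemma trace_adjoint B T T' :
  bilinear_form B -> (forall u w, form (T u) w = form u (T' w)) ->
  trace (fun u w => B (T u) w) = trace (fun u w => B u (T' w)).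
Proof.
move=> [Bl Br] adj.
transitivity (trace (fun u w =>
    trace (fun x y => form u (T' x) * B y w))).
  apply: eq_trace => u w; rewrite -(trace_forml (T u) (Bl w)).
  by apply: eq_trace => x y; rewrite form_sym adj.
rewrite exchange_trace trace_sym; apply: eq_trace => x y.
exact: trace_forml.
Qed.

(** The adjoint of a skew [T] is [- T], so the two terms in which [T] acts on the contracted slots
    cancel. This is why skew derivations commute with contractions. *)
Lemma trace_skew B T :
  bilinear_form B -> (forall u w, form (T u) w = - form u (T w)) ->
  trace (fun u w => B (T u) w) + trace (fun u w => B u (T w)) = 0.
Proof.
move=> lB skew; rewrite (trace_adjoint (T' := fun w => - T w))//.
  rewrite -traceD -[RHS]trace0; apply: eq_trace => u w.
  by rewrite -scaleN1r linear_formZ ?mulN1r ?addNr//; case: lB.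
move=> u w; rewrite skew -[- T w]scaleN1r linear_formZ ?mulN1r//.
exact: form_linr.
Qed.

(** Each diagonal entry of the matrix of [T] is rewritten by inserting the Gram matrix and its
    inverse. *)
Lemma tr_lin1_mx T :
  \tr (lin1_mx T) = trace (fun u w => form (T u) w).
Proof.
rewrite /mxtrace /trace; apply: eq_bigr => a _; rewrite mxE.
rewrite -[T _ in LHS](mulmxK Gunit) mxE; apply: eq_bigr => b _.
rewrite mulrC; congr (_ * _); first by rewrite -[in RHS]Gsym -trmx_inv mxE.
by rewrite /form trmx_delta -colE [RHS]mxE.
Qed.

End Contraction.

(** * Algebraic curvature tensors *)

Section Derivations.
Variables (R : realFieldType) (n : nat).
Local Notation V := 'rV[R]_n.

(** Curried counterpart of [wedge]; [derivation2] and [derivation4] below are those of [derivation]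
    for ranks 2 and 4. *)
Definition wedge_op (A : V -> V -> R) (X Y Z : V) : V :=
  A Y Z *: X - A X Z *: Y.

Definition derivation2 (T : V -> V) (H : V -> V -> R) a b : R :=
  - (H (T a) b + H a (T b)).

Definition derivation4 (T : V -> V) (H : V -> V -> V -> V -> R) a b c d : R :=
  - (H (T a) b c d + H a (T b) c d + H a b (T c) d + H a b c (T d)).

Lemma trace_derivation4_14 (G : 'M[R]_n) T H b c :
  trace G (fun u w => derivation4 T H u b c w)
  = - (trace G (fun u w => H (T u) b c w) + trace G (fun u w => H u (T b) c w)
       + trace G (fun u w => H u b (T c) w)
       + trace G (fun u w => H u b c (T w))).
Proof. by rewrite traceN !traceD. Qed.

Lemma trace_derivation4_23 (G : 'M[R]_n) T H a d :
  trace G (fun u w => derivation4 T H a u w d)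
  = - (trace G (fun u w => H (T a) u w d) + trace G (fun u w => H a (T u) w d)
       + trace G (fun u w => H a u (T w) d)
       + trace G (fun u w => H a u w (T d))).
Proof. by rewrite traceN !traceD. Qed.

End Derivations.

(** * Symmetries, Ricci tensor and projective tensor of an algebraic curvature tensor *)

Section CurvatureAlgebra.
Variables (R : realFieldType) (n : nat) (G : 'M[R]_n).
Local Notation V := 'rV[R]_n.
Local Notation form := (form G).
Local Notation trace := (trace G).
Implicit Types a b c d u v w X Y Z W : V.
Variable Rop : V -> V -> V -> V.

Definition curv a b c d : R := form (Rop a b c) d.
Definition ric b c : R := trace (fun u w => curv u b c w).
Definition ric_op a : V := raise G (ric a).
Definition ric2 a b : R := form (ric_op (ric_op a)) b.
Definition scal : R := trace ric.
Definition curv_ric b c : R := trace (fun u w => curv u b c (ric_op w)).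
Definition ric_wedge a b c d : R := ric b c * form a d - ric a c * form b d.
Definition proj a b c d : R := curv a b c d - (n%:R - 1)^-1 * ric_wedge a b c d.

Hypothesis Gsym : G^T = G.
Hypothesis Gunit : G \in unitmx.
Hypothesis curv12 : forall a b c d, curv a b c d = - curv b a c d.
Hypothesis curv34 : forall a b c d, curv a b c d = - curv a b d c.
Hypothesis curv_cyclic : forall a b c d,
  curv a b c d + curv b c a d + curv c a b d = 0.

(** Octahedron argument: in a signed combination of the four cyclic identities, one for each choice
    of the last argument, the skew symmetries leave only twice the difference of the two sides. *)
Lemma curv_pair a b c d : curv a b c d = curv c d a b.
Proof.
have := curv_cyclic a b c d; have := curv_cyclic b c d a.
have := curv_cyclic c d a b; have := curv_cyclic d a b c.
rewrite (curv34 b c d a) (curv12 a c d b) (curv34 c a d b) (curv12 b d a c).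
rewrite (curv34 d b a c) (curv34 d a b c) (curv34 a b d c) (curv34 c d b a).
lra.
Qed.

Lemma curv_swap a b c d : curv a b c d = curv b a d c.
Proof. by rewrite curv12 curv34 opprK. Qed.

(** Linearity in the last slot comes from [form]; [curv34] and [curv_pair] then carry it to the
    other three slots. *)
Lemma curv_lin4 a b c : linear_form (curv a b c).
Proof. exact: form_linr. Qed.

Lemma curv_lin3 a b d : linear_form (fun c => curv a b c d).
Proof. by move=> k u w; rewrite curv34 curv_lin4 !(curv34 a b _ d); ring. Qed.

Lemma curv_lin2 a c d : linear_form (fun b => curv a b c d).
Proof. by move=> k u w; rewrite !(curv_pair a) curv_lin4. Qed.

Lemma curv_lin1 b c d : linear_form (fun a => curv a b c d).
Proof. by move=> k u w; rewrite !(curv_pair _ b) curv_lin3. Qed.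

Lemma ric_sym a b : ric a b = ric b a.
Proof.
rewrite /ric (trace_sym Gsym); apply: eq_trace => u w.
by rewrite curv_pair curv_swap.
Qed.

Lemma ric_linr a : linear_form (ric a).
Proof. apply: (@trace_lin _ _ G) => u w; exact: curv_lin3. Qed.

Lemma ric_linl b : linear_form (ric^~ b).
Proof. by move=> k u w; rewrite !(ric_sym _ b) ric_linr. Qed.

Lemma form_ric_op a b : form (ric_op a) b = ric a b.
Proof. by rewrite form_raise//; exact: ric_linr. Qed.

Lemma form_ric_opC a b : form a (ric_op b) = ric a b.
Proof. by rewrite form_sym// form_ric_op ric_sym. Qed.

Lemma ric_op_lin k u w : ric_op (k *: u + w) = k *: ric_op u + ric_op w.
Proof.
apply: (form_inj Gunit) => v; rewrite form_linl !form_ric_op.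
exact: ric_linl.
Qed.

Lemma ric_opl a b : ric (ric_op a) b = ric2 a b.
Proof. by rewrite /ric2 form_ric_op. Qed.

Lemma ric_opr a b : ric a (ric_op b) = ric2 a b.
Proof. by rewrite -form_ric_op form_ric_opC ric_opl. Qed.

Lemma ric2_sym a b : ric2 a b = ric2 b a.
Proof. by rewrite -ric_opr ric_sym ric_opl. Qed.

Lemma ric2_linr a : linear_form (ric2 a).
Proof. exact: form_linr. Qed.

Lemma ric2_linl b : linear_form (ric2^~ b).
Proof. by move=> k u w; rewrite !(ric2_sym _ b) ric2_linr. Qed.

Lemma proj_lin1 b c d : linear_form (fun a => proj a b c d).
Proof.
by move=> k u w; rewrite /proj /ric_wedge curv_lin1 form_linl ric_linl; ring.
Qed.

Lemma proj_lin2 a c d : linear_form (fun b => proj a b c d).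
Proof.
by move=> k u w; rewrite /proj /ric_wedge curv_lin2 form_linl ric_linl; ring.
Qed.

Lemma proj_lin3 a b d : linear_form (fun c => proj a b c d).
Proof.
by move=> k u w; rewrite /proj /ric_wedge curv_lin3 !ric_linr; ring.
Qed.

Lemma proj_lin4 a b c : linear_form (proj a b c).
Proof.
by move=> k u w; rewrite /proj /ric_wedge curv_lin4 !form_linr; ring.
Qed.

(** Since S(u, X) = g(u, SX), this is [trace_forml] at the vector [ric_op X]. *)
Lemma trace_ric_mull f X :
  linear_form f -> trace (fun u w => ric u X * f w) = f (ric_op X).
Proof.
move=> lf; rewrite -(trace_forml Gsym Gunit (ric_op X) lf).
by apply: eq_trace => u w; rewrite form_ric_opC.
Qed.

Lemma wedge_opE f A X Y u : linear_form f ->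
  f (wedge_op A X Y u) = A Y u * f X - A X u * f Y.
Proof.
by move=> lf; rewrite /wedge_op (linear_formB _ _ lf) !(linear_formZ _ _ lf).
Qed.

(** Here [A'] is the operator of [A]. The left side expands into contractions against A(Y, .) = g(.,
    A'Y) and A(X, .) = g(., A'X), which insert the vectors A'Y and A'X. *)
Lemma trace_wedge_opl B A A' X Y : bilinear_form B ->
    (forall a b, form a (A' b) = A a b) -> (forall a b, A a b = A b a) ->
  trace (fun u w => B (wedge_op A X Y u) w) = B X (A' Y) - B Y (A' X).
Proof.
move=> [Bl Br] AE As.
rewrite -(trace_forml Gsym Gunit (A' Y) (Br X)).
rewrite -(trace_forml Gsym Gunit (A' X) (Br Y)) -traceB.
apply: eq_trace => u w; rewrite (wedge_opE _ _ _ _ (Bl w)).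
by rewrite !AE (As u Y) (As u X).
Qed.

Lemma trace_wedge_opr B A A' X Y : bilinear_form B ->
    (forall a b, form a (A' b) = A a b) -> (forall a b, A a b = A b a) ->
  trace (fun u w => B u (wedge_op A X Y w)) = B (A' Y) X - B (A' X) Y.
Proof.
move=> [Bl Br] AE As; rewrite (trace_sym Gsym).
by rewrite (trace_wedge_opl (B := fun u w => B w u) _ _ _ AE).
Qed.

(** This and [form_Rop] supply the two operators for the skew contraction lemmas. X /\_S Y is not
    skew in general; its contractions go through [trace_wedge_opl] and [trace_wedge_opr]. *)
Lemma form_wedge_op X Y u w :
  form (wedge_op form X Y u) w = - form u (wedge_op form X Y w).
Proof.
rewrite /wedge_op (form_sym Gsym u) !(linear_formB _ _ (form_linl G _)).
rewrite !(linear_formZ _ _ (form_linl G _)).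
rewrite !(form_sym Gsym _ u) !(form_sym Gsym _ w); ring.
Qed.

Lemma form_Rop X Y u w : form (Rop X Y u) w = - form u (Rop X Y w).
Proof. by rewrite (form_sym Gsym u) -/(curv X Y u w) curv34. Qed.

Hypothesis n_ge3 : (3 <= n)%N.
Local Notation N := (n%:R : R).
Local Notation k := ((N - 1)^-1).

Lemma subN1_neq0 : N - 1 != 0.
Proof. by rewrite subr_eq0 pnatr_eq1 gtn_eqF// (leq_trans _ n_ge3). Qed.

Lemma dim_neq0 : N != 0.
Proof. by rewrite pnatr_eq0 -lt0n (leq_trans _ n_ge3). Qed.

(** The outer trace of [ric_wedge] is n S - S, which the factor 1/(n-1) normalizes to the trace S of
    R. *)
Lemma trace_proj14 b c : trace (fun u w => proj u b c w) = 0.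
Proof.
rewrite traceB traceZ traceB traceZ trace_form// -/(ric b c).
under eq_trace do rewrite mulrC (form_sym Gsym b).
rewrite trace_formr//; last exact: ric_linl.
by field; exact: subN1_neq0.
Qed.

(** The inner trace of R is again S, and that of [ric_wedge] is kappa g - S. *)
Lemma trace_proj23 a d :
  trace (fun u w => proj a u w d) = k * (N * ric a d - scal * form a d).
Proof.
rewrite traceB traceZ traceB traceZr -/scal.
under eq_trace do rewrite curv_swap.
rewrite -/(ric a d).
under eq_trace do rewrite mulrC.
rewrite trace_forml//; last exact: ric_linr.
by field; exact: subN1_neq0.
Qed.

(** * Contractions of derivations by a skew operator *)

Section SkewContraction.
Variable T : V -> V.
Hypothesis T_skew : forall u w, form (T u) w = - form u (T w).

Lemma trace_skew_proj14 b c :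
  trace (fun u w => derivation4 T proj u b c w) = 0.
Proof.
rewrite trace_derivation4_14 !trace_proj14 !addr0.
rewrite (trace_skew Gsym Gunit (B := fun u w => proj u b c w)) ?oppr0//.
by split=> ?; [exact: proj_lin1 | exact: proj_lin4].
Qed.

(** The derivation passes to the inner trace k (n S - kappa g), and a skew [T] kills g. *)
Lemma trace_skew_proj23 a d :
  trace (fun u w => derivation4 T proj a u w d)
  = k * N * derivation2 T ric a d.
Proof.
have := trace_skew Gsym Gunit (B := fun u w => proj a u w d) _ T_skew.
move/(_ (conj (fun w => proj_lin2 _ w _) (fun u => proj_lin3 _ u _))).
move/eqP; rewrite addr_eq0 => /eqP h.
rewrite trace_derivation4_23 !trace_proj23 T_skew /derivation2 h; ring.
Qed.

Lemma trace_skew_curv14 b c :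
  trace (fun u w => derivation4 T curv u b c w) = derivation2 T ric b c.
Proof.
have := trace_skew Gsym Gunit (B := fun u w => curv u b c w) _ T_skew.
move/(_ (conj (fun w => curv_lin1 _ _ w) (fun u => curv_lin4 u _ _))).
move/eqP; rewrite addr_eq0 => /eqP h.
rewrite trace_derivation4_14 h -/(ric (T b) c) -/(ric b (T c)) /derivation2.
ring.
Qed.

Lemma derivation4_ric_wedge a b c d : derivation4 T ric_wedge a b c d
  = derivation2 T ric b c * form a d - derivation2 T ric a c * form b d.
Proof. by rewrite /derivation4 /derivation2 /ric_wedge !T_skew; ring. Qed.

End SkewContraction.


Lemma derivation4_proj T a b c d : derivation4 T proj a b c d
  = derivation4 T curv a b c d - k * derivation4 T ric_wedge a b c d.
Proof. by rewrite /derivation4 /proj; ring. Qed.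

(** * Consequences of P.P = L Q(g,P) at one point *)

Section ProjectivelyPseudosymmetric.
Variable L : R.
(** The left side is P.P, with the operator of P(X,Y) split into R(X,Y) and - k (X /\_S Y). *)
Hypothesis dot_proj_proj : forall a b c d X Y,
  derivation4 (Rop X Y) proj a b c d
    - k * derivation4 (wedge_op ric X Y) proj a b c d
  = L * derivation4 (wedge_op form X Y) proj a b c d.

Local Notation kappa := scal.
Local Notation kappa2 := (trace ric2).

Lemma invN1_neq0 : k != 0.
Proof. by rewrite invr_eq0 subN1_neq0. Qed.

Lemma contraction14 X Y Z W :
  curv X Z W (ric_op Y) + curv (ric_op Y) Z W X
  - curv Y Z W (ric_op X) - curv (ric_op X) Z W Y
  + k * (ric X W * ric Z Y + ric2 Y W * form Z X
         - ric Y W * ric Z X - ric2 X W * form Z Y) = 0.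
Proof.
(* By hypothesis k times this trace is the trace of R.P - L Q(g,P), and skew derivations of a tensor
   without outer trace have no outer trace either. *)
have tr0 : trace (fun u w => derivation4 (wedge_op ric X Y) proj u Z W w) = 0.
  apply: (mulfI invN1_neq0); rewrite mulr0 -traceZ.
  transitivity (trace (fun u w => derivation4 (Rop X Y) proj u Z W w
    - L * derivation4 (wedge_op form X Y) proj u Z W w)).
    by apply: eq_trace => u w; rewrite -dot_proj_proj; ring.
  rewrite traceB traceZ !trace_skew_proj14; first by ring.
    exact: form_wedge_op.
  exact: form_Rop.
have lP : bilinear_form (fun u w => proj u Z W w).
  by split=> ?; [exact: proj_lin1 | exact: proj_lin4].
(* The terms with the wedge in an inner slot are outer traces of P, hence zero; only those with the
   wedge in an outer slot remain. *)
move: tr0; rewrite trace_derivation4_14 !trace_proj14 !addr0.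
rewrite (trace_wedge_opl _ _ lP form_ric_opC ric_sym).
rewrite (trace_wedge_opr _ _ lP form_ric_opC ric_sym).
rewrite /proj /ric_wedge !form_ric_opC !form_ric_op !ric_opl.
rewrite (ric_sym X Y) => h; apply: oppr_inj; rewrite oppr0 -[RHS]h; ring.
Qed.

Lemma curv_ricE Y W : (N - 1) * curv_ric Y W = kappa * ric Y W - ric2 Y W.
Proof.
(* The facts [t1] to [t8] evaluate, term by term, the contraction of [contraction14] over X and Z.
   In [t1] a skew pair meets a symmetric contraction. *)
have t1 : trace (fun u w => curv u w W (ric_op Y)) = 0.
  have : trace (fun u w => curv u w W (ric_op Y))
         = - trace (fun u w => curv u w W (ric_op Y)).
    rewrite [LHS](trace_sym Gsym) -traceN.
    by apply: eq_trace => u w; rewrite curv12.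
  lra.
have t2 : trace (fun u w => curv (ric_op Y) w W u) = - ric2 Y W.
  rewrite (trace_sym Gsym) -ric_opl -traceN.
  by apply: eq_trace => u w; rewrite curv12.
have t3 : trace (fun u w => curv Y w W (ric_op u)) = - curv_ric Y W.
  rewrite (trace_sym Gsym) -traceN.
  by apply: eq_trace => u w; rewrite curv12.
(* Self-adjointness moves the Ricci operator to the second slot; skewness in the first pair then
   makes the trace its own negative. *)
have t4 : trace (fun u w => curv (ric_op u) w W Y) = 0.
  have lB : bilinear_form (fun u w => curv u w W Y).
    by split=> ?; [exact: curv_lin1 | exact: curv_lin2].
  have adj u w : form (ric_op u) w = form u (ric_op w).
    by rewrite form_ric_op form_ric_opC.
  have : trace (fun u w => curv (ric_op u) w W Y)
         = - trace (fun u w => curv (ric_op u) w W Y).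
    rewrite [LHS](trace_adjoint Gsym Gunit lB adj) (trace_sym Gsym) -traceN.
    by apply: eq_trace => u w; rewrite curv12.
  lra.
have t5 : trace (fun u w => ric u W * ric w Y) = ric2 Y W.
  by rewrite (trace_ric_mull _ (ric_linl Y)) ric_opl ric2_sym.
have t6 : trace (fun u w => form w u) = N.
  by rewrite -(trace_sym Gsym) trace_form.
have t7 : trace (fun u w => ric w u) = kappa by rewrite -(trace_sym Gsym).
have t8 : trace (fun u w => ric2 u W * form w Y) = ric2 Y W.
  under eq_trace do rewrite mulrC.
  by rewrite (trace_formr Gsym Gunit _ (ric2_linl W)).
have : trace (fun u w => curv u w W (ric_op Y) + curv (ric_op Y) w W u
  - curv Y w W (ric_op u) - curv (ric_op u) w W Y
  + k * (ric u W * ric w Y + ric2 Y W * form w u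
         - ric Y W * ric w u - ric2 u W * form w Y)) = 0.
  by rewrite -[RHS](trace0 G); apply: eq_trace => u w; rewrite contraction14.
rewrite traceD !traceB traceD traceZ !traceB traceD !traceZ.
rewrite t1 t2 t3 t4 t5 t6 t7 t8.
move=> h.
have {}h : curv_ric Y W
    = ric2 Y W - k * (ric2 Y W + ric2 Y W * N - ric Y W * kappa - ric2 Y W).
  by apply/eqP; rewrite -subr_eq0 -h; apply/eqP; ring.
by rewrite h; field; exact: subN1_neq0.
Qed.

Lemma curv_ric_op_swap X Y Z W : curv X W Z (ric_op Y) = curv (ric_op Y) Z W X.
Proof. by rewrite curv_pair curv_swap. Qed.

(* The curvature terms of [contraction14] are symmetric in [Z] and [W]. *)
Lemma ric_quadratic X Y Z W :
  2 * (ric X W * ric Z Y - ric Y W * ric Z X)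
  + ric2 Y W * form Z X - ric2 X W * form Z Y
  - ric2 Y Z * form W X + ric2 X Z * form W Y = 0.
Proof.
have h1 := contraction14 X Y Z W; have := contraction14 X Y W Z.
rewrite !curv_ric_op_swap -!(curv_ric_op_swap _ _ W Z) => h2.
apply: (mulfI invN1_neq0); rewrite mulr0 -[RHS](subr0 0) -{1}h1 -{1}h2.
by rewrite (ric_sym X Z) (ric_sym W Y) (ric_sym Y Z) (ric_sym W X); ring.
Qed.

(** Contraction of [ric_quadratic] over X and Z: the term 2 S^2 coming from the product of two Ricci
    tensors cancels the two mixed terms - S^2. *)
Lemma ric2E_trace Y W :
  N * ric2 Y W - 2 * kappa * ric Y W + kappa2 * form Y W = 0.
Proof.
have t1 : trace (fun u w => ric u W * ric w Y) = ric2 Y W.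
  by rewrite (trace_ric_mull _ (ric_linl Y)) ric_opl ric2_sym.
have t2 : trace (fun u w => form w u) = N.
  by rewrite -(trace_sym Gsym) trace_form.
have t3 : trace (fun u w => ric w u) = kappa by rewrite -(trace_sym Gsym).
have t4 : trace (fun u w => ric2 u W * form w Y) = ric2 Y W.
  under eq_trace do rewrite mulrC.
  by rewrite (trace_formr Gsym Gunit _ (ric2_linl W)).
have t5 : trace (fun u w => ric2 Y w * form W u) = ric2 Y W.
  under eq_trace do rewrite mulrC (form_sym Gsym).
  by rewrite (trace_forml Gsym Gunit _ (ric2_linr Y)).
have : trace (fun u w => 2 * (ric u W * ric w Y - ric Y W * ric w u)
  + ric2 Y W * form w u - ric2 u W * form w Y
  - ric2 Y w * form W u + ric2 u w * form W Y) = 0.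
  by rewrite -[RHS](trace0 G); apply: eq_trace => u w; rewrite ric_quadratic.
rewrite traceD !traceB traceD traceZ traceB !traceZ traceZr t1 t2 t3 t4 t5.
by move=> h; rewrite -[RHS]h (form_sym Gsym W); ring.
Qed.

Lemma scal2E : kappa2 = kappa ^+ 2 / N.
Proof.
have : trace (fun u w =>
    N * ric2 u w - 2 * kappa * ric u w + kappa2 * form u w) = 0.
  by rewrite -[RHS](trace0 G); apply: eq_trace => u w; rewrite ric2E_trace.
rewrite traceD traceB !traceZ trace_form// -/kappa => h.
apply: (mulfI dim_neq0); rewrite mulrCA divff ?dim_neq0// mulr1.
(* The second contraction yields n kappa2 twice, from the S^2 term and from the g term, against 2
   kappa^2. *)
apply: (mulfI (x := 2)); first by rewrite pnatr_eq0.
apply/eqP; rewrite -subr_eq0 -[X in _ == X]h; apply/eqP; ring.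
Qed.

(** In terms of the Ricci operator this is (n S - kappa)^2 = 0, the form in which [ric_definite]
    exploits it. *)
Lemma ric2E Y W :
  N ^+ 2 * ric2 Y W - 2 * N * kappa * ric Y W + kappa ^+ 2 * form Y W = 0.
Proof.
have := ric2E_trace Y W; rewrite scal2E => /(congr1 ( *%R N)).
rewrite mulr0 => <-; field; exact: dim_neq0.
Qed.

(** The operator n S - kappa is self-adjoint with square zero, so v = (n S - kappa) Y satisfies g(v,
    v) = 0 and vanishes when g is definite. *)
Lemma ric_definite Y W : (forall X, X != 0 -> 0 < form X X) ->
  ric Y W = kappa / N * form Y W.
Proof.
move=> pos; pose v := N *: ric_op Y - kappa *: Y.
have vE Z : form v Z = N * ric Y Z - kappa * form Y Z.
  rewrite (linear_formB _ _ (form_linl G Z)).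
  rewrite !(linear_formZ _ _ (form_linl G Z)).
  by rewrite form_ric_op.
have v0 : v = 0.
  apply/eqP/negPn/negP => /pos; apply/negP; rewrite -leNgt.
  suff -> : form v v = 0 by [].
  rewrite vE !(linear_formB _ _ (form_linr G _)).
  rewrite (linear_formB _ _ (ric_linr _)).
  rewrite !(linear_formZ _ _ (form_linr G _)) !(linear_formZ _ _ (ric_linr _)).
  by rewrite form_ric_opC ric_opr -[RHS](ric2E Y Y); ring.
have := vE W; rewrite v0 (linear_form0 (form_linl G W)) => /eqP.
rewrite eq_sym subr_eq0 => /eqP h; apply: (mulfI dim_neq0); rewrite h.
by field; exact: dim_neq0.
Qed.

Lemma dot_ric a d X Y :
  N * (N - 1) * derivation2 (Rop X Y) ric a d
  = (N ^+ 2 * L - N * L + kappa) * derivation2 (wedge_op form X Y) ric a d.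
Proof.
have lP : bilinear_form (fun u w => proj a u w d).
  by split=> ?; [exact: proj_lin2 | exact: proj_lin3].
have : trace (fun u w => derivation4 (Rop X Y) proj a u w d)
  - k * trace (fun u w => derivation4 (wedge_op ric X Y) proj a u w d)
  = L * trace (fun u w => derivation4 (wedge_op form X Y) proj a u w d).
  rewrite -!traceZ -traceB; apply: eq_trace => u w; exact: dot_proj_proj.
rewrite (trace_skew_proj23 (form_Rop X Y)).
rewrite (trace_skew_proj23 (form_wedge_op X Y)).
rewrite trace_derivation4_23 !trace_proj23.
rewrite (trace_wedge_opl _ _ lP form_ric_opC ric_sym).
rewrite (trace_wedge_opr _ _ lP form_ric_opC ric_sym).
rewrite /proj /ric_wedge !ric_opl !ric_opr !form_ric_op.
(* The trace of Q(S,P) leaves four curvature terms; pair symmetry turns them into those of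
   [contraction14], which eliminates them. *)
have := contraction14 X Y d a.
rewrite (curv_pair a (ric_op Y)) (curv_pair a (ric_op X)) (curv_pair a Y).
rewrite (curv_pair a X).
(* Naming this term shields it from the unfolding of [derivation2], meant for the wedge side
   only. *)
set RS := derivation2 (Rop X Y) ric a d.
rewrite /derivation2 !(wedge_opE _ _ _ _ (ric_linl _)).
rewrite !(wedge_opE _ _ _ _ (ric_linr _)) !(wedge_opE _ _ _ _ (form_linl G _)).
rewrite !(wedge_opE _ _ _ _ (form_linr G _)).
rewrite !(ric_sym X) !(ric_sym Y) !(ric2_sym X) !(ric2_sym Y).
rewrite !(form_sym Gsym X) !(form_sym Gsym Y).
move=> h1 h2; apply/eqP; rewrite -subr_eq0; apply/eqP.
move: h2 => /eqP; rewrite -subr_eq0 => /eqP h2.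
(* The first zero stands for the contracted hypothesis, the second for [contraction14]. *)
transitivity ((N - 1) ^+ 2 * 0 - (N - 1) * 0 : R); last by rewrite !mulr0 subr0.
rewrite -{1}h2 -h1; field; exact: subN1_neq0.
Qed.

(** Contracting [dot_ric] over X and the last argument of S brings in E and S^2, which [curv_ricE]
    and [ric2E] remove. *)
Lemma scal_L_ric Y Z : L * N ^+ 2 * (N * ric Y Z - kappa * form Y Z) = 0.
Proof.
have t1 : trace (fun u w => curv u Y Z (ric_op w)) = curv_ric Y Z by [].
have t2 : trace (fun u w => curv u Y w (ric_op Z)) = - ric2 Y Z.
  rewrite -ric_opr /ric -traceN; apply: eq_trace => u w; exact: curv34.
have t3 : trace (fun u w => form u Z * ric Y w) = ric Y Z.
  by rewrite (trace_forml Gsym Gunit _ (ric_linr Y)).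
have t4 : trace (fun u w => form Y w * ric Z u) = ric Y Z.
  under eq_trace do rewrite (form_sym Gsym).
  by rewrite (trace_formr Gsym Gunit _ (ric_linr Z)) ric_sym.
have : N * (N - 1) * trace (fun u w => derivation2 (Rop u Y) ric Z w)
  = (N ^+ 2 * L - N * L + kappa)
    * trace (fun u w => derivation2 (wedge_op form u Y) ric Z w).
  by rewrite -!traceZ; apply: eq_trace => u w; exact: dot_ric.
have -> : trace (fun u w => derivation2 (Rop u Y) ric Z w)
          = - (curv_ric Y Z - ric2 Y Z).
  rewrite -t1 -t2 -traceD -traceN; apply: eq_trace => u w; rewrite /derivation2.
  by rewrite (ric_sym Z) -!form_ric_opC.
have -> : trace (fun u w => derivation2 (wedge_op form u Y) ric Z w)
          = - (form Y Z * kappa - ric Y Z + (ric Y Z - N * ric Y Z)).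
  transitivity (trace (fun u w => - (form Y Z * ric u w - form u Z * ric Y w
    + (form Y w * ric Z u - form u w * ric Y Z)))).
    apply: eq_trace => u w; rewrite /derivation2.
    rewrite (wedge_opE _ _ _ _ (ric_linl _)) (wedge_opE _ _ _ _ (ric_linr _)).
    by rewrite (ric_sym Y Z).
  rewrite traceN traceD !traceB traceZ traceZr trace_form// t3 t4 -/kappa.
  by ring.
have h1 := curv_ricE Y Z; have h2 := ric2E Y Z.
move=> /eqP; rewrite -subr_eq0 => /eqP h3.
move/eqP: h1; rewrite -subr_eq0 => /eqP h1.
apply: (mulfI subN1_neq0); rewrite mulr0.
(* The zeros stand for [ric2E], the contracted [dot_ric] and [curv_ricE], in this order; in the
   combination E and S^2 cancel. *)
transitivity (N * (0 - 0 - N * 0) : R); last by rewrite !(mulr0, subr0).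
by rewrite -{1}h2 -{1}h3 -h1; ring.
Qed.

(** Either side yields R.S = L Q(g,S) by contraction. As skew operators kill g, the same relation
    holds for [ric_wedge], a multiple of which is the difference of R and P; so R.R = L Q(g,R)
    amounts to R.P = L Q(g,P). *)
Lemma dot_curv_iff :
  (forall a b c d X Y, derivation4 (Rop X Y) curv a b c d
     = L * derivation4 (wedge_op form X Y) curv a b c d)
  <-> (forall a b c d X Y, derivation4 (wedge_op ric X Y) proj a b c d = 0).
Proof.
have ric_wedgeP :
    (forall a d X Y, derivation2 (Rop X Y) ric a d
       = L * derivation2 (wedge_op form X Y) ric a d) ->
    forall a b c d X Y, derivation4 (Rop X Y) ric_wedge a b c d
      = L * derivation4 (wedge_op form X Y) ric_wedge a b c d.
  move=> h a b c d X Y; rewrite (derivation4_ric_wedge (form_Rop X Y)) !h.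
  by rewrite (derivation4_ric_wedge (form_wedge_op X Y)); ring.
split=> h a b c d X Y.
  have /ric_wedgeP hw : forall a d X Y, derivation2 (Rop X Y) ric a d
       = L * derivation2 (wedge_op form X Y) ric a d.
    move=> {}a {}d {}X {}Y; rewrite -(trace_skew_curv14 (form_Rop X Y)).
    rewrite -(trace_skew_curv14 (form_wedge_op X Y)) -traceZ.
    exact: eq_trace.
  apply: (mulfI invN1_neq0); rewrite mulr0.
  have := dot_proj_proj a b c d X Y.
  rewrite (derivation4_proj (Rop X Y)) (derivation4_proj (wedge_op form X Y)).
  rewrite h hw => /eqP; rewrite -subr_eq0 => /eqP e.
  by apply: oppr_inj; rewrite oppr0 -e; ring.
have hP a' b' c' d' X' Y' : derivation4 (Rop X' Y') proj a' b' c' d'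
    = L * derivation4 (wedge_op form X' Y') proj a' b' c' d'.
  by rewrite -dot_proj_proj h mulr0 subr0.
have /ric_wedgeP hw : forall a d X Y, derivation2 (Rop X Y) ric a d
     = L * derivation2 (wedge_op form X Y) ric a d.
  move=> {}a {}d {}X {}Y.
  (* The factor k n is the one that the inner contraction of P puts in front of S. *)
  apply: (mulfI (mulf_neq0 invN1_neq0 dim_neq0)); rewrite mulrCA.
  rewrite -(trace_skew_proj23 (form_Rop X Y)).
  rewrite -(trace_skew_proj23 (form_wedge_op X Y)) -traceZ.
  exact: eq_trace.
have := hP a b c d X Y; rewrite !derivation4_proj hw => e.
set w := derivation4 _ ric_wedge a b c d in e.
by apply: (addIr (- (k * (L * w)))); rewrite e; ring.
Qed.

End ProjectivelyPseudosymmetric.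
End CurvatureAlgebra.

(** * Symmetry of second derivatives *)

Section Schwarz.
Variables (R : realType) (V : normedModType R).
Implicit Types (f : V -> R) (x u v : V).

(** The restriction to the line has at [s] the same difference quotients as [f] at the shifted point
    in direction [u]. *)
Lemma is_derive_shift_line f x u (s : R) : derivable f (x + s *: u) u ->
  is_derive s 1 (fun t => f (x + t *: u)) ('D_u f (x + s *: u)).
Proof.
have E : (fun h : R => h^-1 *: ((fun t => f (x + t *: u)) (h *: (1 : R) + s)
            - f (x + s *: u)))
  = (fun h => h^-1 *: (f (h *: u + (x + s *: u)) - f (x + s *: u))).
  apply/funext => h /=; congr (_ *: (f _ - _)).
  by rewrite scalerDl [h *: 1]mulr1 addrCA.
by move=> df; split; rewrite /derivable /derive /shift /= E.
Qed.

Lemma is_derive_translate f x u w df : is_derive (x + w) u f df ->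
  is_derive x u (fun y => f (y + w)) df.
Proof.
have E : (fun h : R => h^-1 *: (f (h *: u + x + w) - f (x + w)))
       = (fun h => h^-1 *: (f (h *: u + (x + w)) - f (x + w))).
  by apply/funext => h; rewrite addrA.
by move=> [d1 d2]; split; rewrite /derivable /derive /= E.
Qed.

Lemma mean_value_line f df x u (h : R) : 0 < h ->
  (forall s, 0 <= s <= h -> is_derive (x + s *: u) u f (df (x + s *: u))) ->
  exists2 s, 0 <= s <= h & f (x + h *: u) - f x = h * df (x + s *: u).
Proof.
move=> h0 fdf.
have dg s : s \in `[0, h] ->
    is_derive s 1 (fun t => f (x + t *: u)) (df (x + s *: u)).
  rewrite in_itv/= => /fdf[d1 <-]; exact: is_derive_shift_line.
have cg : {within `[0, h], continuous (fun t => f (x + t *: u))}.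
  by apply: derivable_within_continuous => s /dg hs; exact: ex_derive.
have dg' s : s \in `]0, h[ ->
    is_derive s 1 (fun t => f (x + t *: u)) (df (x + s *: u)).
  by move=> hs; apply: dg; exact: subset_itv_oo_cc.
have [s] := MVT h0 dg' cg.
rewrite in_itv/= => /andP[s0 sh]; rewrite scale0r addr0 subr0 mulrC => E.
by exists s; rewrite ?(ltW s0) ?(ltW sh).
Qed.

(** The mean value theorem is applied along [u] to f(y + h v) - f(y), then along [v] to the
    derivative [fu]. *)
Lemma second_difference f fu fvu x u v (h : R) : 0 < h ->
  (forall s t, 0 <= s <= h -> 0 <= t <= h ->
     is_derive (x + s *: u + t *: v) u f (fu (x + s *: u + t *: v))
     /\ is_derive (x + s *: u + t *: v) v fu (fvu (x + s *: u + t *: v))) ->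
  exists s t, [/\ 0 <= s <= h, 0 <= t <= h &
    f (x + h *: u + h *: v) - f (x + h *: u) - f (x + h *: v) + f x
    = h ^+ 2 * fvu (x + s *: u + t *: v)].
Proof.
move=> h0 df.
have hh : 0 <= h <= h by rewrite lexx ltW.
have h00 : 0 <= (0 : R) <= h by rewrite lexx ltW.
have dF s : 0 <= s <= h -> is_derive (x + s *: u) u
   (fun y => f (y + h *: v) - f y) (fu (x + s *: u + h *: v) - fu (x + s *: u)).
  move=> hs; apply: is_deriveB.
    by apply: is_derive_translate; case: (df s h hs hh).
  by have [+ _] := df s 0 hs h00; rewrite scale0r addr0.
have [s hs E] := mean_value_line
  (df := fun y => fu (y + h *: v) - fu y) h0 dF.
have [t ht E2] : exists2 t, 0 <= t <= h &
    fu (x + s *: u + h *: v) - fu (x + s *: u) = h * fvu (x + s *: u + t *: v).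
  by apply: mean_value_line => // t ht; case: (df s t hs ht).
by exists s, t; split=> //; rewrite expr2 -mulrA -E2 -E; ring.
Qed.

(** The second difference is symmetric in [u] and [v], so both mixed derivatives take a common value
    at points arbitrarily close to x; continuity concludes. *)
Lemma derive_comm f fu fv fuv fvu x u v :
  (\forall y \near x, [/\ is_derive y u f (fu y), is_derive y v f (fv y),
     is_derive y v fu (fvu y) & is_derive y u fv (fuv y)]) ->
  {for x, continuous fvu} -> {for x, continuous fuv} -> fuv x = fvu x.
Proof.
move=> df cA cB; apply/eqP; rewrite -subr_eq0 -normr_le0.
apply/ler_addgt0Pr => e e0; rewrite add0r.
have e20 : 0 < e / 2 by rewrite divr_gt0.
have n1 := (cvgrPdist_lt _ _).1 cA _ e20.
have n2 := (cvgrPdist_lt _ _).1 cB _ e20.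
have [r /= r0 rP] := (nbhs_ballP _ _).1 (filterI df (filterI (n1 _) (n2 _))).
(* Chosen so that h (|u| + |v| + 1) = r/2, which keeps the whole parallelogram in the ball; the 1
   makes the denominator positive. *)
pose h := r / (2 * (`|u| + `|v| + 1)).
have c0 : 0 < `|u| + `|v| + 1 by rewrite ltr_wpDl// addr_ge0.
have h0 : 0 < h by rewrite divr_gt0// mulr_gt0.
have inball s t : 0 <= s <= h -> 0 <= t <= h -> ball x r (x + s *: u + t *: v).
  move=> /andP[s0 sh] /andP[t0 th]; rewrite -ball_normE/=.
  rewrite -addrA opprD addrA subrr sub0r normrN.
  rewrite (le_lt_trans (ler_normD _ _))// !normrZ !ger0_norm//.
  have : s * `|u| + t * `|v| <= h * (`|u| + `|v| + 1).
    rewrite !mulrDr mulr1; apply: ler_wpDr; first exact: ltW.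
    by apply: lerD; apply: ler_wpM2r.
  move=> /le_lt_trans; apply; rewrite /h invfM mulrA -mulrA mulVf ?gt_eqF//.
  by rewrite mulr1 ltr_pdivrMr// ltr_pMr// ltr1n.
have [s [t [hs ht E1]]] : exists s t, [/\ 0 <= s <= h, 0 <= t <= h &
    f (x + h *: u + h *: v) - f (x + h *: u) - f (x + h *: v) + f x
    = h ^+ 2 * fvu (x + s *: u + t *: v)].
  by apply: (second_difference (fu := fu)) => // s t hs ht;
    have [[]] := rP _ (inball s t hs ht).
have [s' [t' [hs' ht' E2]]] : exists s t, [/\ 0 <= s <= h, 0 <= t <= h &
    f (x + h *: v + h *: u) - f (x + h *: v) - f (x + h *: u) + f x
    = h ^+ 2 * fuv (x + s *: v + t *: u)].
  apply: (second_difference (fu := fv)) => // s' t' hs' ht'.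
  rewrite -addrA (addrC (s' *: v)) addrA.
  by have [[]] := rP _ (inball t' s' ht' hs').
have {E1 E2} E : fvu (x + s *: u + t *: v)
               = fuv (x + t' *: u + s' *: v).
  apply: (mulfI (expf_neq0 2 (lt0r_neq0 h0))).
  rewrite -E1 -[x + t' *: u + _]addrA (addrC (t' *: u)) addrA -E2.
  by rewrite -!addrA (addrC (h *: v) (h *: u)); ring.
have [_ [d1 _]] := rP _ (inball s t hs ht).
have [_ [_ d2]] := rP _ (inball t' s' ht' hs').
rewrite -(subrKA (fvu (x + s *: u + t *: v))) {1}E.
rewrite (le_trans (ler_normD _ _))// [leRHS]splitr.
by rewrite lerD// ?ltW// distrC.
Qed.

End Schwarz.

(** * Christoffel symbols and the curvature of a metric on an open set *)

Section MatrixDerivable.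
Variables (R : realType) (V : normedModType R) (x v : V).

Lemma derivable_bigsum (I : Type) (r : seq I) (F : I -> V -> R) :
  (forall i, derivable (F i) x v) ->
  derivable (fun y => \sum_(i <- r) F i y) x v.
Proof.
move=> dF; elim: r => [|i r IH].
  by under eq_fun do rewrite big_nil; exact: derivable_cst.
have -> : (fun y => \sum_(j <- i :: r) F j y)
          = F i + (fun y => \sum_(j <- r) F j y).
  by apply/funext => y; rewrite big_cons.
exact: derivableD.
Qed.

Lemma derivable_bigprod (I : Type) (r : seq I) (F : I -> V -> R) :
  (forall i, derivable (F i) x v) ->
  derivable (fun y => \prod_(i <- r) F i y) x v.
Proof.
move=> dF; elim: r => [|i r IH].
  by under eq_fun do rewrite big_nil; exact: derivable_cst.
have -> : (fun y => \prod_(j <- i :: r) F j y)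
          = F i * (fun y => \prod_(j <- r) F j y).
  by apply/funext => y; rewrite big_cons.
exact: derivableM.
Qed.

Lemma derivable_det (m : nat) (A : V -> 'M[R]_m) :
  (forall i j, derivable (fun y => A y i j) x v) ->
  derivable (fun y => \det (A y)) x v.
Proof.
move=> dA; apply: derivable_bigsum => s.
apply: derivableM; first exact: derivable_cst.
by apply: derivable_bigprod => i; exact: dA.
Qed.

Lemma derivable_invmx (m : nat) (A : V -> 'M[R]_m) i j :
  (forall i j, derivable (fun y => A y i j) x v) ->
  (\forall y \near x, A y \in unitmx) ->
  derivable (fun y => invmx (A y) i j) x v.
Proof.
move=> dA uA; have Ax := nbhs_singleton uA.
(* Cramer's formula. It agrees with [invmx] only where the matrix is invertible, since [invmx]
   returns a singular matrix unchanged; hence the comparison near x. *)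
have dB : derivable (fun y => (\det (A y))^-1 * cofactor (A y) j i) x v.
  apply: derivableM.
    apply: derivableV; last exact: derivable_det.
    by rewrite -unitfE -unitmxE.
  apply: derivableM; first exact: derivable_cst.
  apply: derivable_det => k l; under eq_fun do rewrite !mxE; exact: dA.
apply: (near_eq_derivable _ dB).
by near=> y; rewrite /invmx (_ : A y \in unitmx) ?mxE//; near: y.
Unshelve. all: by end_near. Qed.

End MatrixDerivable.

(** * Coordinate symmetries of the curvature of the Levi-Civita connection *)

Section LeviCivita.
Variables (R : realType) (n : nat) (G : 'rV[R]_n -> 'M[R]_n).
Variable U : set 'rV[R]_n.
Implicit Types (a b d e f i j : 'I_n) (x y : 'rV[R]_n).

Hypothesis openU : open U.
Hypothesis G_smooth : forall i j, smooth_on U (fun y => G y i j).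
Hypothesis G_sym : forall y, U y -> (G y)^T = G y.
Hypothesis G_unit : forall y, U y -> G y \in unitmx.

Local Notation g i j := (fun y => G y i j).

Lemma near_open y : U y -> \forall z \near y, U z.
Proof. by move=> Uy; exact: open_nbhs_nbhs. Qed.

Lemma eq_pderiv a (f h : 'rV[R]_n -> R) y :
  U y -> (forall z, U z -> f z = h z) -> pderiv a f y = pderiv a h y.
Proof.
by move=> /near_open Uy fh; apply: near_eq_derive; apply: filterS Uy.
Qed.

Lemma smooth_derivable h a y :
  smooth_on U h -> U y -> derivable h y (evec R a).
Proof. by move=> /(_ 1)[_ /(_ a)[+ _]]; apply. Qed.

Lemma smooth_pderiv_derivable h a b y :
  smooth_on U h -> U y -> derivable (pderiv a h) y (evec R b).
Proof. by move=> /(_ 2)[_ /(_ a)[_ [_ /(_ b)[+ _]]]]; apply. Qed.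

Lemma pderiv_comm h a b y : smooth_on U h -> U y ->
  pderiv a (pderiv b h) y = pderiv b (pderiv a h) y.
Proof.
move=> hs Uy.
apply: (derive_comm (f := h) (fu := pderiv a h) (fv := pderiv b h)
  (u := evec R a) (v := evec R b)).
- apply: filterS (near_open Uy) => z Uz; split; apply: derivableP.
  + exact: smooth_derivable.
  + exact: smooth_derivable.
  + exact: smooth_pderiv_derivable.
  + exact: smooth_pderiv_derivable.
- have [_ /(_ a)[_ [_ /(_ b)[_ [+ _]]]]] := hs 2; exact.
- have [_ /(_ b)[_ [_ /(_ a)[_ [+ _]]]]] := hs 2; exact.
Qed.

Lemma G_symE i j y : U y -> G y i j = G y j i.
Proof. by move=> Uy; rewrite -[in LHS](G_sym Uy) mxE. Qed.

Lemma pderiv_G_sym a i j y : U y -> pderiv a (g i j) y = pderiv a (g j i) y.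
Proof. by move=> Uy; apply: eq_pderiv => // z; exact: G_symE. Qed.

(** Christoffel symbol of the first kind, with [f] as the lowered index. *)
Definition christoffel1 f b d y : R :=
  2^-1 * (pderiv b (g d f) y + pderiv d (g b f) y - pderiv f (g b d) y).

Lemma christoffelE e b d y :
  christoffel G e b d y = \sum_(f < n) invmx (G y) e f * christoffel1 f b d y.
Proof.
rewrite /christoffel mulr_sumr; apply: eq_bigr => f _.
by rewrite /christoffel1 mulrCA.
Qed.

Lemma sum_G_christoffel f b d y : U y ->
  \sum_(e < n) G y f e * christoffel G e b d y = christoffel1 f b d y.
Proof.
move=> Uy; under eq_bigr => e _ do rewrite christoffelE mulr_sumr.
rewrite exchange_big/=.
under eq_bigr => h _ do under eq_bigr => e _ do rewrite mulrA.
under eq_bigr => h _ do rewrite -mulr_suml.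
have E h : \sum_(e < n) G y f e * invmx (G y) e h = (f == h)%:R.
  by have /matrixP/(_ f h) := mulmxV (G_unit Uy); rewrite !mxE.
under eq_bigr => h _ do rewrite E.
rewrite (bigD1 f)//= eqxx mul1r big1 ?addr0// => h hf.
by rewrite eq_sym (negbTE hf) mul0r.
Qed.

Lemma christoffel_sym e b d y :
  U y -> christoffel G e b d y = christoffel G e d b y.
Proof.
move=> Uy; rewrite !christoffelE; apply: eq_bigr => f _; congr (_ * _).
by rewrite /christoffel1 (pderiv_G_sym f b d Uy) (addrC (pderiv b _ _)).
Qed.

(** Compatibility of the connection with the metric. *)
Lemma pderiv_metric a d f y : U y ->
  pderiv a (g d f) y = christoffel1 f a d y + christoffel1 d a f y.
Proof.
by move=> Uy; rewrite /christoffel1 (pderiv_G_sym a f d Uy); field.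
Qed.

Lemma christoffel1_derivable f b d a y :
  U y -> derivable (christoffel1 f b d) y (evec R a).
Proof.
move=> Uy; apply: derivableM; first exact: derivable_cst.
by apply: derivableB; [apply: derivableD|];
  apply: smooth_pderiv_derivable => //; exact: G_smooth.
Qed.

Lemma christoffel_derivable e b d a y :
  U y -> derivable (christoffel G e b d) y (evec R a).
Proof.
move=> Uy; rewrite (_ : christoffel G e b d = fun y =>
    \sum_(f < n) invmx (G y) e f * christoffel1 f b d y).
  apply: derivable_bigsum => f.
  apply: derivableM; last exact: christoffel1_derivable.
  apply: derivable_invmx => [i j|].
    by apply: smooth_derivable => //; exact: G_smooth.
  by apply: filterS (near_open Uy) => z; exact: G_unit.
by apply/funext => z; exact: christoffelE.
Qed.

(** Product rule on [sum_G_christoffel]; the derivative of the inverse Gram matrix never has to be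
    computed. *)
Lemma pderiv_christoffel1 a b d f y : U y -> pderiv a (christoffel1 f b d) y
  = \sum_(e < n) (pderiv a (g f e) y * christoffel G e b d y
                  + G y f e * pderiv a (christoffel G e b d) y).
Proof.
move=> Uy; pose F e : 'rV[R]_n -> R := g f e * christoffel G e b d.
rewrite (eq_pderiv (h := \sum_(e < n) F e) a Uy); last first.
  by move=> z Uz; rewrite fct_sumE -sum_G_christoffel.
have dg e : derivable (g f e) y (evec R a).
  by apply: smooth_derivable => //; exact: G_smooth.
have dc e : derivable (christoffel G e b d) y (evec R a).
  exact: christoffel_derivable.
rewrite /pderiv derive_sum; last by move=> e; exact: derivableM.
by apply: eq_bigr => e _; rewrite deriveM// addrC mulrC.
Qed.

(** The component R(e_a, e_b, e_d, e_f) of the (0,4)-tensor. *)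
Definition curvature_low a b d f y : R :=
  \sum_(e < n) curvature_comp G e a b d y * G y e f.

(** This is g(nabla_a e_f, nabla_b e_d), which explains the symmetry [christoffel_prodC]. *)
Definition christoffel_prod a f b d y : R :=
  \sum_(h < n) christoffel1 h a f y * christoffel G h b d y.

Lemma christoffel_prodC a f b d y :
  U y -> christoffel_prod a f b d y = christoffel_prod b d a f y.
Proof.
move=> Uy; rewrite /christoffel_prod.
under eq_bigr => h _ do rewrite -sum_G_christoffel// mulr_suml.
under [RHS]eq_bigr => h _ do rewrite -sum_G_christoffel// mulr_suml.
rewrite exchange_big/=; do 2!apply: eq_bigr => ? _.
by rewrite G_symE//; ring.
Qed.

(** Lowering the index inside the derivative costs a product of a derivative of g with a Christoffel
    symbol. By [pderiv_metric] it splits into the quadratic term of the curvature, which cancels,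
    and a [christoffel_prod]. *)
Lemma curvature_lowE a b d f y : U y -> curvature_low a b d f y
  = pderiv a (christoffel1 f b d) y - pderiv b (christoffel1 f a d) y
    - christoffel_prod a f b d y + christoffel_prod b f a d y.
Proof.
move=> Uy.
have quad a' b' : \sum_(e < n) G y f e
      * (\sum_(h < n) christoffel G e a' h y * christoffel G h b' d y)
    = \sum_(h < n) christoffel1 f a' h y * christoffel G h b' d y.
  under eq_bigr => e _ do rewrite mulr_sumr.
  rewrite exchange_big/=; apply: eq_bigr => h _.
  by rewrite -sum_G_christoffel// mulr_suml;
    apply: eq_bigr => e _; rewrite mulrA.
have met a' b' : \sum_(e < n) pderiv a' (g f e) y * christoffel G e b' d y
    = \sum_(h < n) christoffel1 f a' h y * christoffel G h b' d y
      + christoffel_prod a' f b' d y.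
  rewrite -big_split/=; apply: eq_bigr => e _.
  by rewrite pderiv_metric//; ring.
pose D a' b' := \sum_(e < n) G y f e * pderiv a' (christoffel G e b' d) y.
pose Q a' b' := \sum_(e < n) G y f e
  * (\sum_(h < n) christoffel G e a' h y * christoffel G h b' d y).
have der a' b' : pderiv a' (christoffel1 f b' d) y
    = Q a' b' + christoffel_prod a' f b' d y + D a' b'.
  by rewrite pderiv_christoffel1// big_split/= met -quad.
have low : curvature_low a b d f y = D a b - D b a + (Q a b - Q b a).
  rewrite /D /Q -!sumrB -big_split/=; apply: eq_bigr => e _.
  rewrite /curvature_comp sumrB (G_symE e f Uy).
  by rewrite [LHS]mulrC mulrDr !mulrBr.
rewrite low (der a b) (der b a); clearbody D Q.
move: (christoffel_prod a f b d y) (christoffel_prod b f a d y) => P1 P2.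
by ring.
Qed.

(** Adding the two sides, the derivative terms combine to a commutator of second derivatives of
    g_df, which vanishes, and the products cancel by [christoffel_prodC]. *)
Lemma curvature_low34 a b d f y :
  U y -> curvature_low a b d f y = - curvature_low a b f d y.
Proof.
(* Kept apart from the derivatives, since [lra] and [ring] compare atoms up to
   conversion and would unfold the limits defining them. *)
have alg (A B C D P Q P' Q' : R) : A + B = C + D -> P = Q' -> P' = Q ->
    A - C - P + Q = - (B - D - P' + Q') by lra.
move=> Uy.
have dd a' b' : pderiv a' (christoffel1 f b' d) y
      + pderiv a' (christoffel1 d b' f) y = pderiv a' (pderiv b' (g d f)) y.
  rewrite /pderiv -deriveD; try exact: christoffel1_derivable.
  by apply/esym; apply: eq_pderiv => // z; exact: pderiv_metric.
have c : pderiv a (christoffel1 f b d) y + pderiv a (christoffel1 d b f) y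
    = pderiv b (christoffel1 f a d) y + pderiv b (christoffel1 d a f) y.
  exact: etrans (dd a b) (etrans (pderiv_comm a b (G_smooth d f) Uy)
    (esym (dd b a))).
rewrite (curvature_lowE a b d f Uy) (curvature_lowE a b f d Uy).
exact: (alg _ _ _ _ _ _ _ _ c (christoffel_prodC a f b d Uy)
  (christoffel_prodC a d b f Uy)).
Qed.

Lemma curvature_comp12 e a b d y :
  curvature_comp G e a b d y = - curvature_comp G e b a d y.
Proof.
rewrite /curvature_comp opprD opprB -sumrN; congr (_ + _).
by apply: eq_bigr => f _; rewrite opprB.
Qed.

(** First Bianchi identity: the connection is torsion free, and with symmetric Christoffel symbols
    all terms cancel in cyclic pairs. *)
Lemma curvature_comp_cyclic e a b d y : U y ->
  curvature_comp G e a b d y + curvature_comp G e b d a y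
  + curvature_comp G e d a b y = 0.
Proof.
have alg (A B C S1 S2 S3 : R) : S1 + S2 + S3 = 0 ->
    A - B + S1 + (B - C + S2) + (C - A + S3) = 0 by lra.
have alg2 (A B C : R) : A - B + (B - C) + (C - A) = 0 by ring.
move=> Uy; rewrite /curvature_comp.
have s i j k := @eq_pderiv k _ _ y Uy (fun z => @christoffel_sym e i j z).
rewrite (s b d) (s a d) (s a b); apply: alg.
rewrite -!big_split/= big1// => f _.
rewrite (christoffel_sym f b d Uy) (christoffel_sym f a d Uy).
by rewrite (christoffel_sym f a b Uy) alg2.
Qed.

End LeviCivita.

Lemma sum3_cyclic (R : nmodType) (n : nat) (F : 'I_n -> 'I_n -> 'I_n -> R) :
  \sum_a \sum_b \sum_d F a b d = \sum_a \sum_b \sum_d F b d a.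
Proof.
rewrite [RHS](exchange_big_dep xpredT)//=; apply: eq_bigr => a _.
by rewrite exchange_big.
Qed.

(** * From components to arbitrary tangent vectors *)

Section CurvatureOperator.
Variables (R : realType) (n : nat) (G : 'rV[R]_n -> 'M[R]_n).
Variable U : set 'rV[R]_n.
Hypothesis openU : open U.
Hypothesis G_smooth : forall i j, smooth_on U (fun y => G y i j).
Hypothesis G_sym : forall y, U y -> (G y)^T = G y.
Hypothesis G_unit : forall y, U y -> G y \in unitmx.
Variable x : 'rV[R]_n.
Hypothesis Ux : U x.
Implicit Types X Y Z W : 'rV[R]_n.

Lemma curvE X Y Z W : curv (G x) (curvature_op G x) X Y Z W
  = \sum_a \sum_b \sum_d \sum_f
      curvature_low G a b d f x * (X 0 a * Y 0 b) * (Z 0 d * W 0 f).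
Proof.
rewrite /curv /form mxE.
under eq_bigr => f _.
  rewrite mxE [W^T _ _]mxE.
  under eq_bigr => e _.
    rewrite mxE !mulr_suml.
    under eq_bigr => a _.
      rewrite !mulr_suml.
      under eq_bigr => b _ do rewrite !mulr_suml.
      over.
    over.
  rewrite exchange_big/= mulr_suml.
  under eq_bigr => a _.
    rewrite exchange_big/= mulr_suml.
    under eq_bigr => b _.
      rewrite exchange_big/= mulr_suml.
      over.
    over.
  over.
rewrite exchange_big/=; apply: eq_bigr => a _.
rewrite exchange_big/=; apply: eq_bigr => b _.
rewrite exchange_big/=; apply: eq_bigr => d _; apply: eq_bigr => f _.
rewrite /curvature_low !mulr_suml; apply: eq_bigr => e _.
by move: (curvature_comp G e a b d x) => C; ring.
Qed.

Lemma curvature_op12 X Y Z W : curv (G x) (curvature_op G x) X Y Z W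
  = - curv (G x) (curvature_op G x) Y X Z W.
Proof.
rewrite !curvE -sumrN exchange_big/=; apply: eq_bigr => b _.
rewrite -sumrN; apply: eq_bigr => a _; rewrite -sumrN; apply: eq_bigr => d _.
rewrite -sumrN; apply: eq_bigr => f _.
have -> : curvature_low G a b d f x = - curvature_low G b a d f x.
  rewrite /curvature_low -sumrN; apply: eq_bigr => e _.
  by rewrite curvature_comp12 mulNr.
by rewrite (mulrC (Y 0 b)) !mulNr.
Qed.

Lemma curvature_op34 X Y Z W : curv (G x) (curvature_op G x) X Y Z W
  = - curv (G x) (curvature_op G x) X Y W Z.
Proof.
rewrite !curvE -sumrN; apply: eq_bigr => a _.
rewrite -sumrN; apply: eq_bigr => b _; rewrite exchange_big/= -sumrN.
apply: eq_bigr => f _; rewrite -sumrN; apply: eq_bigr => d _.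
rewrite (curvature_low34 openU G_smooth G_sym G_unit a b d f Ux).
by rewrite (mulrC (W 0 f)) !mulNr.
Qed.

Lemma curvature_op_cyclic X Y Z W : curv (G x) (curvature_op G x) X Y Z W
  + curv (G x) (curvature_op G x) Y Z X W
  + curv (G x) (curvature_op G x) Z X Y W = 0.
Proof.
have alg (A B C p q r s : R) : A + B + C = 0 -> A * (p * q) * (r * s)
    + B * (q * r) * (p * s) + C * (r * p) * (q * s) = 0.
  by move=> h; rewrite -[RHS](mul0r (p * q * r * s)) -h; ring.
(* Cyclic renaming, once in the second sum and twice in the third, attaches a, b, d to X, Y, Z in
   all three. *)
rewrite !curvE [X in _ + X + _]sum3_cyclic [X in _ + _ + X]sum3_cyclic.
rewrite [X in _ + _ + X]sum3_cyclic -!big_split/= big1// => a _.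
rewrite -!big_split/= big1// => b _; rewrite -!big_split/= big1// => d _.
rewrite -!big_split/= big1// => f _.
apply: alg; rewrite /curvature_low -!big_split/= big1// => e _.
by rewrite -!mulrDl (curvature_comp_cyclic openU G_sym e a b d Ux) mul0r.
Qed.

End CurvatureOperator.

(** * The identities at a point of the manifold *)

Section Tuples.
Variables (R : realType) (n : nat).
Local Notation V := 'rV[R]_n.

Lemma tuple4E (x : 4.-tuple V) : x = [tuple x`_0; x`_1; x`_2; x`_3].
Proof. by apply/val_inj; case: x => [[|a [|b [|c [|d []]]]]]. Qed.

Lemma tuple6E (x : 6.-tuple V) :
  x = [tuple x`_0; x`_1; x`_2; x`_3; x`_4; x`_5].
Proof. by apply/val_inj; case: x => [[|a [|b [|c [|d [|X [|Y []]]]]]]]. Qed.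

Lemma derivation_tuple2 T (H : tensor R n 2) a b :
  derivation T H [tuple a; b] = derivation2 T (fun a b => H [tuple a; b]) a b.
Proof.
rewrite /derivation !big_ord_recr big_ord0 /= add0r /derivation2.
by do ![congr (_ + _) | congr (- _) | congr H];
  apply: eq_from_tnth => -[[|[]]]// ?; rewrite tnth_mktuple !(tnth_nth 0).
Qed.

Lemma derivation_tuple4 T (H : tensor R n 4) a b c d :
  derivation T H [tuple a; b; c; d]
  = derivation4 T (fun a b c d => H [tuple a; b; c; d]) a b c d.
Proof.
rewrite /derivation !big_ord_recr big_ord0 /= add0r /derivation4.
by do ![congr (_ + _) | congr (- _) | congr H];
  apply: eq_from_tnth => -[[|[|[|[]]]]]// ?; rewrite tnth_mktuple !(tnth_nth 0).
Qed.

Lemma take_tuple4 (a b c d X Y : V) :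
  [tuple [tuple a; b; c; d; X; Y]`_i | i < 4] = [tuple a; b; c; d].
Proof.
by apply: eq_from_tnth => -[[|[|[|[]]]]]// ?; rewrite tnth_mktuple (tnth_nth 0).
Qed.

Lemma take_tuple2 (a b X Y : V) :
  [tuple [tuple a; b; X; Y]`_i | i < 2] = [tuple a; b].
Proof.
by apply: eq_from_tnth => -[[|[]]]// ?; rewrite tnth_mktuple (tnth_nth 0).
Qed.

End Tuples.

(** * The curvature tensors in a chart at one point *)

Section AtPoint.
Variables (R : realType) (n : nat) (M : smoothManifold R n).
Variables (g : semiRiemannianMetric M) (c : chart M) (p : M).
Hypothesis cp : dom c p.
Implicit Types a b d X Y Z W : 'rV[R]_n.

Let G := gram_at g c p.
Let Rop := curvature_op (gram g c) (Defs.coord c p).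
Local Notation curv := (curv G Rop).
Local Notation ric := (ric G Rop).
Local Notation proj := (proj G Rop).
Local Notation ric_wedge := (ric_wedge G Rop).

Lemma coord_dom : (Defs.coord c @` dom c) (Defs.coord c p).
Proof. by exists p. Qed.

Lemma gram_at_sym : G^T = G.
Proof. exact: gram_sym coord_dom. Qed.

Lemma gram_at_unit : G \in unitmx.
Proof. exact: gram_nondegenerate coord_dom. Qed.

Lemma curv_at12 a b d e : curv a b d e = - curv b a d e.
Proof. exact: curvature_op12. Qed.

Lemma curv_at34 a b d e : curv a b d e = - curv a b e d.
Proof.
have h := curvature_op34 (@coord_open _ _ M c) (@gram_smooth _ _ _ g c)
  (@gram_sym _ _ _ g c) (@gram_nondegenerate _ _ _ g c) coord_dom a b d e.
exact: h.
Qed.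

Lemma curv_at_cyclic a b d e : curv a b d e + curv b d a e + curv d a b e = 0.
Proof.
exact: (curvature_op_cyclic (@coord_open _ _ M c) (@gram_sym _ _ _ g c)
  coord_dom).
Qed.

Lemma endo_riemann X Y Z : endo g (riemann g) c p X Y Z = Rop X Y Z.
Proof.
apply: (form_inj gram_at_unit) => W; rewrite /endo [sharp _ _ _ _]/(raise G _).
by rewrite (form_raise gram_at_unit _ (form_linr G (Rop X Y Z))).
Qed.

(** [ric_wedge] is X /\_S Y with its index lowered, and pairing with every [W] determines a
    vector. *)
Lemma endo_projective X Y Z : endo g (projective g) c p X Y Z
  = Rop X Y Z - (n%:R - 1)^-1 *: wedge_op ric X Y Z.
Proof.
apply: (form_inj gram_at_unit) => W.
rewrite [endo _ _ _ _ _ _ _]/(raise G (proj X Y Z)).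
rewrite form_raise ?gram_at_unit//; last first.
  by apply: proj_lin4.
rewrite (linear_formB _ _ (form_linl G W)) (linear_formZ _ _ (form_linl G W)).
rewrite (linear_formB _ _ (form_linl G W)) !(linear_formZ _ _ (form_linl G W)).
by [].
Qed.

Lemma derivation4_endo_projective X Y H a b d e :
  (forall b d e, linear_form (fun a => H a b d e)) ->
  (forall a d e, linear_form (fun b => H a b d e)) ->
  (forall a b e, linear_form (fun d => H a b d e)) ->
  (forall a b d, linear_form (H a b d)) ->
  derivation4 (endo g (projective g) c p X Y) H a b d e
  = derivation4 (Rop X Y) H a b d e
    - (n%:R - 1)^-1 * derivation4 (wedge_op ric X Y) H a b d e.
Proof.
move=> l1 l2 l3 l4; rewrite /derivation4 !endo_projective.
rewrite (linear_formB _ _ (l1 _ _ _)) (linear_formZ _ _ (l1 _ _ _)).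
rewrite (linear_formB _ _ (l2 _ _ _)) (linear_formZ _ _ (l2 _ _ _)).
rewrite (linear_formB _ _ (l3 _ _ _)) (linear_formZ _ _ (l3 _ _ _)).
by rewrite (linear_formB _ _ (l4 _ _ _)) (linear_formZ _ _ (l4 _ _ _)); ring.
Qed.

Lemma dot_tuple4 D (H : tfield M 4) a b d e X Y :
  dot g D H c p [tuple a; b; d; e; X; Y]
  = derivation4 (endo g D c p X Y) (fun a b d e => H c p [tuple a; b; d; e])
      a b d e.
Proof. by rewrite /dot take_tuple4 derivation_tuple4. Qed.

Lemma tachibana_tuple4 A (H : tfield M 4) a b d e X Y :
  tachibana A H c p [tuple a; b; d; e; X; Y]
  = derivation4 (wedge_op (fun a b => A c p [tuple a; b]) X Y)
      (fun a b d e => H c p [tuple a; b; d; e]) a b d e.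
Proof. by rewrite /tachibana take_tuple4 derivation_tuple4. Qed.

Lemma dot_tuple2 D (H : tfield M 2) a b X Y :
  dot g D H c p [tuple a; b; X; Y]
  = derivation2 (endo g D c p X Y) (fun a b => H c p [tuple a; b]) a b.
Proof. by rewrite /dot take_tuple2 derivation_tuple2. Qed.

Lemma tachibana_tuple2 A (H : tfield M 2) a b X Y :
  tachibana A H c p [tuple a; b; X; Y]
  = derivation2 (wedge_op (fun a b => A c p [tuple a; b]) X Y)
      (fun a b => H c p [tuple a; b]) a b.
Proof. by rewrite /tachibana take_tuple2 derivation_tuple2. Qed.

Section Identities.
Hypothesis n_ge3 : (3 <= n)%N.
Variable L : R.
Hypothesis dot_proj_proj : forall x,
  dot g (projective g) (projective g) c p x
  = L * tachibana (metric g) (projective g) c p x.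

Let Gsym := gram_at_sym.
Let Gunit := gram_at_unit.
Let c12 := curv_at12.
Let c34 := curv_at34.
Let cyc := curv_at_cyclic.
Local Notation k := ((n%:R - 1)^-1 : R).

Lemma endo_projective_proj X Y a b d e :
  derivation4 (endo g (projective g) c p X Y) proj a b d e
  = derivation4 (Rop X Y) proj a b d e
    - k * derivation4 (wedge_op ric X Y) proj a b d e.
Proof.
apply: derivation4_endo_projective => ? ? ?; [by apply: proj_lin1 |
  by apply: proj_lin2 | by apply: proj_lin3 | by apply: proj_lin4].
Qed.

Lemma dot_proj_projE a b d e X Y :
  derivation4 (Rop X Y) proj a b d e
    - k * derivation4 (wedge_op ric X Y) proj a b d e
  = L * derivation4 (wedge_op (form G) X Y) proj a b d e.
Proof.
have := dot_proj_proj [tuple a; b; d; e; X; Y].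
by rewrite dot_tuple4 tachibana_tuple4 [LHS]endo_projective_proj.
Qed.

Lemma dot_riemann4E (H : tfield M 4) a b d e X Y :
  dot g (riemann g) H c p [tuple a; b; d; e; X; Y]
  = derivation4 (Rop X Y) (fun a b d e => H c p [tuple a; b; d; e]) a b d e.
Proof. by rewrite dot_tuple4 /derivation4 !endo_riemann. Qed.

Lemma dot_projective_riemann_iff :
  (forall x, dot g (projective g) (riemann g) c p x
     = L * tachibana (metric g) (riemann g) c p x)
  <-> (forall x, dot g (riemann g) (wedgeS g) c p x
     = L * tachibana (metric g) (wedgeS g) c p x
       + k * tachibana (ricci g) (wedgeS g) c p x).
Proof.
have E a b d e X Y : derivation4 (endo g (projective g) c p X Y) curv a b d e
    = derivation4 (Rop X Y) curv a b d e
      - k * derivation4 (wedge_op ric X Y) curv a b d e.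
  by apply: derivation4_endo_projective => ? ? ?; [by apply: curv_lin1 |
    by apply: curv_lin2 | by apply: curv_lin3 | by apply: curv_lin4].
(* The letters r, q, t stand for R., Q(S,.), Q(g,.) applied to R, the primed ones for the same
   applied to [ric_wedge]; the premise is the hypothesis P.P = L Q(g,P) expanded. *)
have alg (r r' q q' t t' : R) :
    r - k * r' - k * (q - k * q') = L * (t - k * t') ->
    (r - k * q = L * t <-> r' = L * t' + k * q').
  have k0 : k != 0 by rewrite invr_eq0 subN1_neq0.
  move=> h; split=> h1.
    apply: (mulfI k0); transitivity (r - k * q + k * k * q'
      - (r - k * r' - k * (q - k * q'))); first by ring.
    by rewrite h h1; ring.
  transitivity (r - k * r' - k * (q - k * q') + k * r' - k * k * q').
    by ring.
  by rewrite h h1; ring.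
have key a b d e X Y : derivation4 (Rop X Y) curv a b d e
      - k * derivation4 (wedge_op ric X Y) curv a b d e
    = L * derivation4 (wedge_op (form G) X Y) curv a b d e
  <-> derivation4 (Rop X Y) ric_wedge a b d e
    = L * derivation4 (wedge_op (form G) X Y) ric_wedge a b d e
      + k * derivation4 (wedge_op ric X Y) ric_wedge a b d e.
  by apply: alg; rewrite -!derivation4_proj dot_proj_projE.
split=> h x; have := h x; rewrite (tuple6E x) dot_riemann4E dot_tuple4.
  by rewrite !tachibana_tuple4 => hx; apply/key; rewrite -E.
by rewrite !tachibana_tuple4 => hx; rewrite [LHS]E; apply/key.
Qed.

(** By hypothesis R.P - L Q(g,P) equals k Q(S,P), and k is nonzero. *)
Lemma dot_riemann_projective_iff :
  (forall x, dot g (riemann g) (projective g) c p x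
     = L * tachibana (metric g) (projective g) c p x)
  <-> (forall x, tachibana (ricci g) (projective g) c p x = 0).
Proof.
have k0 : k != 0 by rewrite invr_eq0 subN1_neq0.
split=> h x; rewrite (tuple6E x).
  rewrite tachibana_tuple4; apply: (mulfI k0); rewrite mulr0.
  apply: oppr_inj; rewrite oppr0.
  have := dot_proj_projE x`_0 x`_1 x`_2 x`_3 x`_4 x`_5.
  have := h x; rewrite (tuple6E x) dot_riemann4E tachibana_tuple4 => -> /eqP.
  by rewrite eq_sym -subr_eq0 opprB addrC subrK => /eqP ->; rewrite oppr0.
rewrite dot_riemann4E tachibana_tuple4 -[RHS]dot_proj_projE.
by have := h x; rewrite (tuple6E x) tachibana_tuple4 => ->; rewrite mulr0 subr0.
Qed.

Lemma dot_riemann_riemann_iff :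
  (forall x, dot g (riemann g) (riemann g) c p x
     = L * tachibana (metric g) (riemann g) c p x)
  <-> (forall x, tachibana (ricci g) (projective g) c p x = 0).
Proof.
have := dot_curv_iff Gsym Gunit c12 c34 cyc n_ge3 dot_proj_projE.
move=> [h1 h2]; split=> h x; rewrite (tuple6E x).
  rewrite tachibana_tuple4; apply: h1 => a b d e X Y.
  by have := h [tuple a; b; d; e; X; Y]; rewrite dot_riemann4E tachibana_tuple4.
rewrite dot_riemann4E tachibana_tuple4; apply: h2 => a b d e X Y.
by have := h [tuple a; b; d; e; X; Y]; rewrite tachibana_tuple4.
Qed.

Lemma dot_riemann_ricci x :
  n%:R * (n%:R - 1) * dot g (riemann g) (ricci g) c p x
  = (n%:R ^+ 2 * L - n%:R * L + scalar_curvature g c p)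
    * tachibana (metric g) (ricci g) c p x.
Proof.
rewrite (tuple4E x) dot_tuple2 tachibana_tuple2 {1}/derivation2 !endo_riemann.
exact: (dot_ric Gsym Gunit c12 c34 cyc n_ge3 dot_proj_projE).
Qed.

Lemma tensorE_identity x : (n%:R - 1) * tensorE g c p x
  = scalar_curvature g c p * ricci g c p x - ricci2 g c p x.
Proof. exact: (curv_ricE Gsym Gunit c12 c34 cyc n_ge3 dot_proj_projE). Qed.

Lemma ricci2_identity x : n%:R ^+ 2 * ricci2 g c p x
  - 2 * n%:R * scalar_curvature g c p * ricci g c p x
  + scalar_curvature g c p ^+ 2 * metric g c p x = 0.
Proof. exact: (ric2E Gsym Gunit c12 c34 cyc n_ge3 dot_proj_projE). Qed.

(** The matrix trace of the squared Ricci operator is first turned into the contraction of S^2. *)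
Lemma scalar_curvature2_identity :
  scalar_curvature2 g c p = scalar_curvature g c p ^+ 2 / n%:R.
Proof.
rewrite /scalar_curvature2 (tr_lin1_mx Gsym Gunit).
exact: (scal2E Gsym Gunit c12 c34 cyc n_ge3 dot_proj_projE).
Qed.

Lemma ricci_definite x : (forall X, X != 0 -> 0 < metric g c p [tuple X; X]) ->
  ricci g c p x = scalar_curvature g c p / n%:R * metric g c p x.
Proof. exact: (ric_definite Gsym Gunit c12 c34 cyc n_ge3 dot_proj_projE). Qed.

Lemma ricci_L_identity x : L * n%:R ^+ 2
  * (n%:R * ricci g c p x - scalar_curvature g c p * metric g c p x) = 0.
Proof. exact: (scal_L_ric Gsym Gunit c12 c34 cyc n_ge3 dot_proj_projE). Qed.

End Identities.

End AtPoint.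

(** * Assembly of the pointwise identities over all charts and points *)

Theorem theorem4p10 (R : realType) (n : nat) (M : smoothManifold R n)
  (g : semiRiemannianMetric M) (L : M -> R) :
  (3 <= n)%N ->
  connected [set: M] ->
  smooth_fun L ->
  everywhere (fun c p => forall x,
    dot g (projective g) (projective g) c p x
    = L p * tachibana (metric g) (projective g) c p x) ->
  (* (i) *)
  (everywhere (fun c p => forall x,
     dot g (projective g) (riemann g) c p x
     = L p * tachibana (metric g) (riemann g) c p x)
   <->
   everywhere (fun c p => forall x,
     dot g (riemann g) (wedgeS g) c p x
     = L p * tachibana (metric g) (wedgeS g) c p x
       + (n%:R - 1)^-1 * tachibana (ricci g) (wedgeS g) c p x))
  /\
  (* (ii) *)
  (everywhere (fun c p => forall x,
     dot g (riemann g) (projective g) c p x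
     = L p * tachibana (metric g) (projective g) c p x)
   <->
   everywhere (fun c p => forall x,
     tachibana (ricci g) (projective g) c p x = 0))
  /\
  (* (iii) *)
  (everywhere (fun c p => forall x,
     dot g (riemann g) (riemann g) c p x
     = L p * tachibana (metric g) (riemann g) c p x)
   <->
   everywhere (fun c p => forall x,
     tachibana (ricci g) (projective g) c p x = 0))
  /\
  (* (iv) *)
  everywhere (fun c p => forall x,
    n%:R * (n%:R - 1) * dot g (riemann g) (ricci g) c p x
    = (n%:R ^+ 2 * L p - n%:R * L p + scalar_curvature g c p)
      * tachibana (metric g) (ricci g) c p x)
  /\
  (* (v) *)
  everywhere (fun c p => forall x,
    (n%:R - 1) * tensorE g c p x
    = scalar_curvature g c p * ricci g c p x - ricci2 g c p x)
  /\
  (* (vi) *)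
  (everywhere (fun c p => forall x,
     n%:R ^+ 2 * ricci2 g c p x
     - 2 * n%:R * scalar_curvature g c p * ricci g c p x
     + scalar_curvature g c p ^+ 2 * metric g c p x = 0)
   /\ everywhere (fun c p =>
        scalar_curvature2 g c p = scalar_curvature g c p ^+ 2 / n%:R)
   /\ (riemannian g -> einstein g))
  /\
  (* (vii) *)
  (everywhere (fun c p => forall x,
     L p * n%:R ^+ 2
     * (n%:R * ricci g c p x - scalar_curvature g c p * metric g c p x) = 0)
   /\ ((forall p : M, L p != 0) -> einstein g)).
Proof.
move=> n3 _ _ H.
have n0 : n%:R != 0 :> R by exact: dim_neq0.
have Hp c p : dom c p -> _ := H c p.
repeat split.
- by move=> h c p cp; apply/(dot_projective_riemann_iff cp n3 (Hp c p cp))/h.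
- by move=> h c p cp; apply/(dot_projective_riemann_iff cp n3 (Hp c p cp))/h.
- by move=> h c p cp; apply/(dot_riemann_projective_iff cp n3 (Hp c p cp))/h.
- by move=> h c p cp; apply/(dot_riemann_projective_iff cp n3 (Hp c p cp))/h.
- by move=> h c p cp; apply/(dot_riemann_riemann_iff cp n3 (Hp c p cp))/h.
- by move=> h c p cp; apply/(dot_riemann_riemann_iff cp n3 (Hp c p cp))/h.
- by move=> c p cp x; exact: (dot_riemann_ricci cp n3 (Hp c p cp)).
- by move=> c p cp x; exact: (tensorE_identity cp n3 (Hp c p cp)).
- by move=> c p cp x; exact: (ricci2_identity cp n3 (Hp c p cp)).
- by move=> c p cp; exact: (scalar_curvature2_identity cp n3 (Hp c p cp)).
- move=> pos c p cp x.
  exact: (ricci_definite cp n3 (Hp c p cp) _ (pos c p cp)).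
- by move=> c p cp x; exact: (ricci_L_identity cp n3 (Hp c p cp)).
move=> L0 c p cp x; have /eqP := ricci_L_identity cp n3 (Hp c p cp) x.
(* Where L does not vanish, the factor L n^2 cancels from the identity and leaves n S = kappa g. *)
have c0 : L p * n%:R ^+ 2 != 0 by rewrite mulf_neq0// expf_neq0.
rewrite mulf_eq0 (negbTE c0) subr_eq0 => /eqP h; apply: (mulfI n0).
rewrite h mulrA; congr (_ * _).
by rewrite mulrCA divff// mulr1.
Qed.
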